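(* Let $\mathcal{T}$ be an associative conformal algebra, $\mathcal{U}$ a conformal $\mathcal{T}$-bimodule, $H$ a Hochschild $2$-cocycle of $\mathcal{T}$ with coefficients in $\mathcal{U}$, $R:\mathcal{U}\to\mathcal{T}$ a conformal $H$-twisted Rota-Baxter operator, and $(\mathcal{U},*_\lambda)$ the associative conformal algebra induced by $R$. Then $$H^{m}_R(\mathcal{U},\mathcal{T})\simeq H^{m}_{Hoch}(\mathcal{U},\mathcal{T})\qquad\text{for all } m\ge 0,$$ where $H^{m}_R(\mathcal{U},\mathcal{T})$ is the cohomology of the conformal $H$-twisted Rota-Baxter operator $R$ and $H^{m}_{Hoch}(\mathcal{U},\mathcal{T})$ is the Hochschild cohomology of $(\mathcal{U},*_\lambda)$ with coefficients in the conformal $(\mathcal{U},*_\lambda)$-bimodule $\mathcal{T}$ with actions $\mathfrak{l}^R_\lambda,\mathfrak{r}^R_\lambda$.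
   Context: Everything is over $\mathbb{C}$. An associative conformal algebra is a $\mathbb{C}[\partial]$-module $\mathcal{T}$ with a bilinear $\lambda$-product $\mathcal{T}\otimes\mathcal{T}\to\mathcal{T}[\lambda]$, $p\otimes q\mapsto p_\lambda q$, that is conformally sesquilinear ($(\partial p)_\lambda q=-\lambda\,p_\lambda q$, $p_\lambda(\partial q)=(\partial+\lambda)(p_\lambda q)$) and satisfies $(p_\lambda q)_{\lambda+\mu}r=p_\lambda(q_\mu r)$. A conformal $\mathcal{T}$-bimodule is a $\mathbb{C}[\partial]$-module $\mathcal{U}$ with conformally sesquilinear maps $\mathcal{T}\otimes\mathcal{U}\to\mathcal{U}[\lambda]$, $(p,u)\mapsto p_\lambda u$ and $\mathcal{U}\otimes\mathcal{T}\to\mathcal{U}[\lambda]$, $(u,p)\mapsto u_\lambda p$, with $(p_\lambda u)_{\lambda+\mu}q=p_\lambda(u_\mu q)$, $(u_\lambda p)_{\lambda+\mu}q=u_\lambda(p_\mu q)$, $(p_\lambda q)_{\lambda+\mu}u=p_\lambda(q_\mu u)$. A Hochschild $2$-cocycle is a conformally sesquilinear map $H_\lambda:\mathcal{T}\otimes\mathcal{T}\to\mathcal{U}[\lambda]$ with ${p_1}_{\lambda_1}H_{\lambda_2}(p_2,p_3)-H_{\lambda_1+\lambda_2}({p_1}_{\lambda_1}p_2,p_3)+H_{\lambda_1}(p_1,{p_2}_{\lambda_2}p_3)-H_{\lambda_1}(p_1,p_2)_{\lambda_1+\lambda_2}p_3=0$. $\mathbb{C}[\partial]$-linear maps are extended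 coefficientwise to polynomials in $\lambda$. A conformal $H$-twisted Rota-Baxter operator is a $\mathbb{C}[\partial]$-linear map $R:\mathcal{U}\to\mathcal{T}$ with $R(u)_\lambda R(v)=R\big(u_\lambda R(v)+R(u)_\lambda v+H_\lambda(R(u),R(v))\big)$ for all $u,v\in\mathcal{U}$. It induces on $\mathcal{U}$ the associative conformal product $u*_\lambda v=u_\lambda R(v)+R(u)_\lambda v+H_\lambda(R(u),R(v))$, and $\mathcal{T}$ is a conformal $(\mathcal{U},*_\lambda)$-bimodule with left action $\mathfrak{l}^R_\lambda(u,p)=R(u)_\lambda p-R(u_\lambda p+H_\lambda(R(u),p))$ and right action $\mathfrak{r}^R_\lambda(p,u)=p_\lambda R(u)-R(p_\lambda u+H_\lambda(p,R(u)))$. Cochains. For $\mathbb{C}[\partial]$-modules $V,W$ and $m\ge1$, $\mathrm{Hom}(V^{\otimes m},W)$ is the space of multilinear maps $f_{\lambda_1,\dots,\lambda_{m-1}}:V^{\otimes m}\to W[\lambda_1,\dots,\lambda_{m-1}]$ with $f_{\lambda_1,\dots,\lambda_{m-1}}(x_1,\dots,\partial x_j,\dots,x_m)=-\lambda_jf_{\lambda_1,\dots,\lambda_{m-1}}(x_1,\dots,x_m)$ for $j<m$ and $f_{\lambda_1,\dots,\lambda_{m-1}}(x_1,\dots,\partial x_m)=(\partial+\lambda_1+\dots+\lambda_{m-1})f_{\lambda_1,\dots,\lambda_{m-1}}(x_1,\dots,x_m)$; $\mathrm{Hom}(V^{\otimes0},W)=W$. Convention: in an expression with $N$ arguments, only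 $\lambda_1,\dots,\lambda_{N-1}$ are free; if $\lambda_N$ occurs it means $-\partial-\lambda_1-\dots-\lambda_{N-1}$ with $\partial$ acting from the left on the whole expression; an empty sum of $\lambda$'s is $0$. Operator cohomology. For $f\in\mathrm{Hom}(V^{\otimes m},V)$, $g\in\mathrm{Hom}(V^{\otimes n},V)$ put $[f,g]_G=f\circ g-(-1)^{(m-1)(n-1)}g\circ f$, $f\circ g=\sum_{i=1}^m(-1)^{(i-1)(n-1)}f\circ_ig$, where $f\circ_ig$ inserts $g$ in the $i$-th slot: $(f\circ_ig)(x_1,\dots,x_{m+n-1})=f_{\lambda_1,\dots,\lambda_{i-1},\lambda_i+\dots+\lambda_{i+n-1},\lambda_{i+n},\dots}(x_1,\dots,g_{\lambda_i,\dots,\lambda_{i+n-2}}(x_i,\dots,x_{i+n-1}),\dots)$. On $\mathcal{T}\oplus\mathcal{U}$ let $\pi_\lambda((p,u),(q,v))=(p_\lambda q,p_\lambda v+u_\lambda q)$ and extend elements of $\mathrm{Hom}(\mathcal{U}^{\otimes m},\mathcal{T})$ to $\mathcal{T}\oplus\mathcal{U}$ by zero. For $A,B,C$ in $\mathrm{Hom}(\mathcal{U}^{\otimes a},\mathcal{T})$, $\mathrm{Hom}(\mathcal{U}^{\otimes b},\mathcal{T})$, $\mathrm{Hom}(\mathcal{U}^{\otimes c},\mathcal{T})$ define $\llbracket A,B\rrbracket=(-1)^a[[\pi,A]_G,B]_G$, $$A\langle B,C\rangle=\sum_{j=1}^a(-1)^{(j-1)b}A\big(u_1,\dots,u_{j-1},H(B(u_j,\dots,u_{j+b-1}),C(u_{j+b},\dots,u_{j+b+c-1})),u_{j+b+c},\dots\big)$$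 (where $A$ has parameter $\lambda_j+\dots+\lambda_{j+b+c-1}$ in slot $j$ and the parameters of the corresponding $u$'s in the other slots, $H$ has parameter $\lambda_j+\dots+\lambda_{j+b-1}$, $B$ has $\lambda_j,\dots,\lambda_{j+b-2}$, $C$ has $\lambda_{j+b},\dots,\lambda_{j+b+c-2}$), and $$\llbracket A,B,C\rrbracket=(-1)^{abc}\big\{A\langle B,C\rangle-(-1)^{bc}A\langle C,B\rangle-(-1)^{ab}B\langle A,C\rangle+(-1)^{a(b+c)}B\langle C,A\rangle-(-1)^{ab+bc+ca}C\langle B,A\rangle+(-1)^{c(a+b)}C\langle A,B\rangle\big\}.$$ Define $d_R:\mathrm{Hom}(\mathcal{U}^{\otimes m},\mathcal{T})\to\mathrm{Hom}(\mathcal{U}^{\otimes(m+1)},\mathcal{T})$ by $d_R(g)=\llbracket R,g\rrbracket-\frac12\llbracket R,R,g\rrbracket$; it is a differential, and $H^m_R(\mathcal{U},\mathcal{T})$ is its cohomology $Z^m_R/B^m_R$ with $Z^m_R=\{g\in\mathrm{Hom}(\mathcal{U}^{\otimes m},\mathcal{T}):d_R(g)=0\}$, $B^m_R=\{d_R(h):h\in\mathrm{Hom}(\mathcal{U}^{\otimes(m-1)},\mathcal{T})\}$. Hochschild cohomology $H^m_{Hoch}(\mathcal{U},\mathcal{T})$ is the cohomology of $C^m_{Hoch}(\mathcal{U},\mathcal{T})=\mathrm{Hom}(\mathcal{U}^{\otimes m},\mathcal{T})$ with $$(\delta_{Hoch}g)_{\lambda_1,\dots,\lambda_m}(u_1,\dots,u_{m+1})=\mathfrak{l}^R_{\lambda_1}(u_1,g_{\lambda_2,\dots,\lambda_m}(u_2,\dots,u_{m+1}))+\sum_{j=1}^m(-1)^jg_{\lambda_1,\dots,\lambda_j+\lambda_{j+1},\dots,\lambda_m}(u_1,\dots,u_j*_{\lambda_j}u_{j+1},\dots,u_{m+1})+(-1)^{m+1}\mathfrak{r}^R_{\lambda_1+\dots+\lambda_m}(g_{\lambda_1,\dots,\lambda_{m-1}}(u_1,\dots,u_m),u_{m+1}).$$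 *)

(* Defs.v *)
From HB Require Import structures.
From mathcomp Require Import all_boot all_order all_algebra.
From mathcomp Require Import boolp functions finmap monalg.

Set Implicit Arguments.
Unset Strict Implicit.
Unset Printing Implicit Defensive.

Import GRing.Theory.
Local Open Scope ring_scope.
Local Open Scope quotient_scope.

(* A C[∂]-module is an [lmodType {poly K}] with K := C: ∂ acts as ['X *: _], a
   scalar c as [c%:P *: _]. *)

Definition lmon n : conomType := {cmonom 'I_n}.

(* K[∂][λ_1, ..., λ_n] *)
Definition lring (K : fieldType) n : comNzRingType := {malg {poly K}[lmon n]}.

(* W[λ_1, ..., λ_n] *)
Definition lpol (K : fieldType) n (W : lmodType {poly K}) : Type :=
  {malg W[lmon n]}.

HB.instance Definition _ K n W :=
  GRing.Zmodule.copy (@lpol K n W) {malg W[lmon n]}.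

Definition lpol_const (K : fieldType) n (W : lmodType {poly K}) (w : W) :
  lpol n W := << w *g (mone : lmon n) >>.

HB.lock Definition malg_scale (K : fieldType) (I : choiceType)
    (W : lmodType {poly K}) (c : K) (p : {malg W[I]}) : {malg W[I]} :=
  \sum_(a <- msupp p) << c%:P *: p@_a *g a >>.

(* The action of K[∂][λ_1, ..., λ_n] on W[λ_1, ..., λ_n]. *)
HB.lock Definition lact (K : fieldType) n (W : lmodType {poly K})
    (q : lring K n) (p : lpol n W) : lpol n W :=
  \sum_(a <- msupp q) \sum_(b <- msupp p) << q@_a *: p@_b *g mmul a b >>.

(* The substitution λ_(i+1) := s i; ∂ may occur in s i, and then acts from the
   left on the coefficients. *)
HB.lock Definition lsubst (K : fieldType) n n' (W : lmodType {poly K})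
    (s : 'I_n -> lring K n') (p : lpol n W) : lpol n' W :=
  \sum_(a <- msupp p)
    lact (\prod_i s i ^+ (a : {cmonom 'I_n}) i) (lpol_const n' p@_a).

(* The coefficientwise extension of phi to polynomial arguments. *)
HB.lock Definition lext (K : fieldType) n (V W : lmodType {poly K})
    (phi : V -> lpol n W) (X : lpol n V) : lpol n W :=
  \sum_(a <- msupp X) lact << a >> (phi X@_a).

Section LambdaPolynomials.
Context {K : fieldType}.
Implicit Types V W : lmodType {poly K}.

Lemma malg_scaleE (I : choiceType) W c (p : {malg W[I]}) a :
  (malg_scale c p)@_a = c%:P *: p@_a.
Proof.
rewrite malg_scale.unlock [in RHS](monalgE p) !raddf_sum.
by apply/eq_bigr => b _ /=; rewrite !mcoeffU scalerMnr.
Qed.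

Section ScalarMultiplication.
Context (n : nat) (W : lmodType {poly K}).
Local Notation scale := (@malg_scale K (lmon n) W).

Fact lpol_scaleA c d p : scale c (scale d p) = scale (c * d) p.
Proof. by apply/malgP => a; rewrite !malg_scaleE scalerA polyCM. Qed.

Fact lpol_scale1 : left_id 1 scale.
Proof. by move=> p; apply/malgP => a; rewrite malg_scaleE scale1r. Qed.

Fact lpol_scaleDr : right_distributive scale +%R.
Proof.
by move=> c p q; apply/malgP => a; rewrite malg_scaleE !mcoeffD !malg_scaleE scalerDr.
Qed.

Fact lpol_scaleDl p : {morph scale^~ p : c d / c + d}.
Proof.
by move=> c d; apply/malgP => a; rewrite mcoeffD !malg_scaleE polyCD scalerDl.
Qed.

HB.instance Definition _ := GRing.Zmodule_isLmodule.Build K (lpol n W)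
  lpol_scaleA lpol_scale1 lpol_scaleDr lpol_scaleDl.
End ScalarMultiplication.

(* λ_(k+1), indices starting at 0; only meant for k < n. *)
Definition lvar n (k : nat) : lring K n :=
  if insub k is Some i then << ucm (i : 'I_n) >> else 0.

Definition del n : lring K n := ('X : {poly K})%:MP.

(* Expressions with N arguments are first computed with N independent variables,
   then the last one is replaced by -∂-λ_1-...-λ_(N-1). *)
Definition lreduce n W : lpol n W -> lpol n.-1 W :=
  lsubst (fun k : 'I_n =>
    if (k < n.-1)%N then lvar n.-1 k
    else - del n.-1 - \sum_(i < n.-1) lvar n.-1 i).

Definition lmap n V W (phi : V -> W) : lpol n V -> lpol n W :=
  lext (fun v => lpol_const n (phi v)).

Definition lambda_product V1 V2 W := V1 -> V2 -> lpol 1 W.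

Definition conf_sesquilinear V1 V2 W (f : lambda_product V1 V2 W) : Prop :=
  [/\ forall c x y v, f (c%:P *: x + y) v = c *: f x v + f y v,
      forall c x v w, f x (c%:P *: v + w) = c *: f x v + f x w,
      forall x v, f ('X *: x) v = lact (- lvar 1 0) (f x v)
    & forall x v, f x ('X *: v) = lact (del 1 + lvar 1 0) (f x v)].

(* [lprod f s X Y] is X _s Y for polynomial arguments X and Y. *)
Definition lprod n V1 V2 W (f : lambda_product V1 V2 W) (s : lring K n)
    (X : lpol n V1) (Y : lpol n V2) : lpol n W :=
  lext (fun x => lext (fun y => lsubst (fun=> s) (f x y)) Y) X.

End LambdaPolynomials.

Arguments lvar {K} n k.
Arguments del {K} n.
Arguments lpol_const {K n W} w.

Section ConformalStructures.
Context {K : fieldType}.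

Local Notation la := (lvar 2 0 : lring K 2).
Local Notation mu := (lvar 2 1 : lring K 2).
Local Notation "x %:L" := (lpol_const x) (at level 2, format "x %:L").

Record conf_algebra := ConfAlgebra {
  conf_sort :> lmodType {poly K};
  cmul : lambda_product conf_sort conf_sort conf_sort;
  cmul_sesquilinear : conf_sesquilinear cmul;
  cmul_assoc : forall p q r : conf_sort,
    lprod cmul (la + mu) (lprod cmul la p%:L q%:L) r%:L
    = lprod cmul la p%:L (lprod cmul mu q%:L r%:L) }.

Record conf_bimodule (T : conf_algebra) := ConfBimodule {
  bimod_sort :> lmodType {poly K};
  lmul : lambda_product T bimod_sort bimod_sort;
  rmul : lambda_product bimod_sort T bimod_sort;
  lmul_sesquilinear : conf_sesquilinear lmul;
  rmul_sesquilinear : conf_sesquilinear rmul;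
  lmul_rmul : forall (p : T) (u : bimod_sort) (q : T),
    lprod rmul (la + mu) (lprod lmul la p%:L u%:L) q%:L
    = lprod lmul la p%:L (lprod rmul mu u%:L q%:L);
  rmul_cmul : forall (u : bimod_sort) (p q : T),
    lprod rmul (la + mu) (lprod rmul la u%:L p%:L) q%:L
    = lprod rmul la u%:L (lprod (@cmul T) mu p%:L q%:L);
  cmul_lmul : forall (p q : T) (u : bimod_sort),
    lprod lmul (la + mu) (lprod (@cmul T) la p%:L q%:L) u%:L
    = lprod lmul la p%:L (lprod lmul mu q%:L u%:L) }.

Record cocycle2 (T : conf_algebra) (U : conf_bimodule T) := Cocycle2 {
  cocycle_fun : lambda_product T T U;
  cocycle_sesquilinear : conf_sesquilinear cocycle_fun;
  cocycle_eq : forall p1 p2 p3 : T,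
    lprod (@lmul T U) la p1%:L (lprod cocycle_fun mu p2%:L p3%:L)
    - lprod cocycle_fun (la + mu) (lprod (@cmul T) la p1%:L p2%:L) p3%:L
    + lprod cocycle_fun la p1%:L (lprod (@cmul T) mu p2%:L p3%:L)
    - lprod (@rmul T U) (la + mu) (lprod cocycle_fun la p1%:L p2%:L) p3%:L = 0 }.

Section TwistedRotaBaxter.
Context (T : conf_algebra) (U : conf_bimodule T) (H : cocycle2 U).

(* u *_λ v, for an arbitrary map R. *)
Definition induced_mul (R : U -> T) : lambda_product U U U := fun u v =>
  rmul u (R v) + lmul (R u) v + cocycle_fun H (R u) (R v).

Definition induced_lact (R : U -> T) : lambda_product U T T := fun u p =>
  cmul (R u) p - lmap R (rmul u p + cocycle_fun H (R u) p).

Definition induced_ract (R : U -> T) : lambda_product T U T := fun p u =>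
  cmul p (R u) - lmap R (lmul p u + cocycle_fun H p (R u)).

Record twisted_RB := TwistedRB {
  RB_fun :> {linear U -> T};
  RB_eq : forall u v : U,
    cmul (RB_fun u) (RB_fun v) = lmap RB_fun (induced_mul RB_fun u v) }.

End TwistedRotaBaxter.

End ConformalStructures.

Arguments conf_algebra K : clear implicits.
Arguments induced_mul {K T U} H R.
Arguments induced_lact {K T U} H R.
Arguments induced_ract {K T U} H R.

Section Cochains.
Context {K : fieldType}.
Implicit Types V W : lmodType {poly K}.

Definition cochain m V W : Type := m.-tuple V -> lpol m.-1 W.

HB.instance Definition _ m V W :=
  GRing.Lmodule.copy (cochain m V W) (m.-tuple V -> lpol m.-1 W).

Definition tupdate m V (x : m.-tuple V) (j : 'I_m) (v : V) : m.-tuple V :=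
  [tuple if k == j then v else tnth x k | k < m].

Definition is_Hom m V W (f : cochain m V W) : Prop :=
  [/\ forall (x : m.-tuple V) (j : 'I_m) c v w,
        f (tupdate x j (c%:P *: v + w)) = c *: f (tupdate x j v) + f (tupdate x j w),
      forall (x : m.-tuple V) (j : 'I_m) v, (j < m.-1)%N ->
        f (tupdate x j ('X *: v)) = lact (- lvar m.-1 j) (f (tupdate x j v))
    & forall (x : m.-tuple V) (j : 'I_m) v, j = m.-1 :> nat ->
        f (tupdate x j ('X *: v))
        = lact (del m.-1 + \sum_(i < m.-1) lvar m.-1 i) (f (tupdate x j v))].

(* The entries (or parameters) of a cochain whose slot i has been filled with z,
   z using up w entries of y. *)
Definition splice S (i w : nat) (z : S) (y : nat -> S) (k : nat) : S :=
  if (k < i)%N then y k else if k == i then z else y (k.-1 + w)%N.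

Section Insertion.
Context (N : nat) (V : lmodType {poly K}) (x : N.-tuple V).

(* f_{..., λ_(i+1) + ... + λ_(i+w), ...}(..., X, ...), with X in slot i *)
Definition insert m W (f : cochain m V W) (i w : nat) (X : lpol N V) : lpol N W :=
  lext (fun v => lsubst
    (fun k : 'I_m.-1 => splice i w (\sum_(i <= l < i + w) lvar N l) (lvar N) k)
    (f [tuple splice i w v (nth 0 x) k | k < m])) X.

(* g_{λ_(i+1), ..., λ_(i+n-1)}(x_(i+1), ..., x_(i+n)) *)
Definition consecutive n W (g : cochain n V W) (i : nat) : lpol N W :=
  lsubst (fun k : 'I_n.-1 => lvar N (i + k)) (g [tuple nth 0 x (i + k) | k < n]).

End Insertion.

(* f \circ g, with N = m + n - 1. As n may be 0, the sign (-1)^{(i-1)(n-1)} is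
   written with n + 1 in place of n - 1. *)
Definition gcirc N m n V (f : cochain m V V) (g : cochain n V V) : cochain N V V :=
  fun x => \sum_(i < m)
    (-1) ^+ (i * n.+1) *: lreduce (insert x f i n (consecutive x g i)).

End Cochains.

Arguments gcirc {K} N {m n V} f g.

Definition gbracket (K : fieldType) m n (V : lmodType {poly K}) (f : cochain m V V) (g : cochain n V V) :
    cochain (m + n).-1 V V :=
  gcirc (m + n).-1 f g - (-1) ^+ (m.+1 * n.+1) *: gcirc (m + n).-1 g f.

Section OperatorBracket.
Context {K : fieldType} (T : conf_algebra K) (U : conf_bimodule T).

Local Notation TU := (T * U)%type.

Definition semidirect : cochain 2 TU TU := fun x =>
  let: (p, u) := tnth x 0 in let: (q, v) := tnth x 1 in
  lmap (fun t : T => (t, 0) : TU) (cmul p q)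
  + lmap (fun w : U => (0, w) : TU) (lmul p v + rmul u q).

Definition extend m (g : cochain m U T) : cochain m TU TU := fun x =>
  lmap (fun t : T => (t, 0) : TU) (g [tuple (tnth x k).2 | k < m]).

(* Recovers g from [extend g]; the derived bracket below only takes values which
   are extensions by zero. *)
Definition restrict m (G : cochain m TU TU) : cochain m U T := fun x =>
  lmap fst (G [tuple ((0, tnth x k) : TU) | k < m]).

Definition bracket2 a b (A : cochain a U T) (B : cochain b U T) :
    cochain (a + b) U T :=
  (-1) ^+ a *: restrict (gbracket (gbracket semidirect (extend A)) (extend B)).

End OperatorBracket.

Section TernaryBracket.
Context {K : fieldType} (T : conf_algebra K) (U : conf_bimodule T) (H : cocycle2 U).

(* A<B, C>, with N = a + b + c - 1 *)
Definition plug N a b c (A : cochain a U T) (B : cochain b U T)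
    (C : cochain c U T) : cochain N U T :=
  fun x => \sum_(j < a) (-1) ^+ (j * b) *: lreduce (insert x A j (b + c)
    (lprod (cocycle_fun H) (\sum_(j <= l < j + b) lvar N l)
       (consecutive x B j) (consecutive x C (j + b)))).

End TernaryBracket.

Arguments plug {K T U} H N {a b c} A B C.

Section OperatorDifferential.
Context {K : fieldType} (T : conf_algebra K) (U : conf_bimodule T) (H : cocycle2 U).

Definition bracket3 a b c (A : cochain a U T) (B : cochain b U T)
    (C : cochain c U T) : cochain (a + b + c).-1 U T :=
  let N := (a + b + c).-1 in
  (-1) ^+ (a * b * c) *: (plug H N A B C
    - (-1) ^+ (b * c) *: plug H N A C B
    - (-1) ^+ (a * b) *: plug H N B A C
    + (-1) ^+ (a * (b + c)) *: plug H N B C A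
    - (-1) ^+ (a * b + b * c + c * a) *: plug H N C B A
    + (-1) ^+ (c * (a + b)) *: plug H N C A B).

Definition cochain1 (R : U -> T) : cochain 1 U T := fun x =>
  lpol_const (R (tnth x 0)).

Definition d_RB (R : U -> T) m (g : cochain m U T) : cochain m.+1 U T :=
  bracket2 (cochain1 R) g
  - 2%:R^-1 *: bracket3 (cochain1 R) (cochain1 R) g.

End OperatorDifferential.

Section HochschildDifferential.
Context {K : fieldType} (U T : lmodType {poly K}).
Context (mul : lambda_product U U U).
Context (l : lambda_product U T T) (r : lambda_product T U T).

Definition d_Hoch m (g : cochain m U T) : cochain m.+1 U T := fun x =>
  let N := m.+1 in let xc k := lpol_const (nth 0 x k) : lpol N U in
  lreduce (lprod l (lvar N 0) (xc 0%N) (consecutive x g 1)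
    + \sum_(j < m) (-1) ^+ j.+1 *:
        insert x g j 2 (lprod mul (lvar N j) (xc j) (xc j.+1))
    + (-1) ^+ m.+1 *: lprod r (\sum_(k < m) lvar N k) (consecutive x g 0) (xc m)).

End HochschildDifferential.

Section Linearity.
Context {K : fieldType}.
Implicit Types V W : lmodType {poly K}.

Definition klinear V (M : lmodType K) (phi : V -> M) : Prop :=
  forall c v w, phi (c%:P *: v + w) = c *: phi v + phi w.

Lemma klinear0 V (M : lmodType K) (phi : V -> M) : klinear phi -> phi 0 = 0.
Proof.
move=> h; have := h (-1) 0 0.
by rewrite scaler0 addr0 scaleN1r addNr.
Qed.

Lemma mcoeff_lin n W c (p q : lpol n W) a :
  (c *: p + q : {malg W[lmon n]})@_a = c%:P *: p@_a + q@_a.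
Proof. by rewrite mcoeffD; congr (_ + _); exact: malg_scaleE. Qed.

Lemma sum_msupp_linear n W (M : lmodType K) (F : lmon n -> W -> M) :
  (forall a, klinear (F a)) ->
  linear (fun p : lpol n W => \sum_(a <- msupp p) F a p@_a).
Proof.
move=> hF c p q.
have F0 a : F a 0 = 0 by apply: klinear0.
have widen d (r : lpol n W) : (msupp r `<=` d)%fset ->
    \sum_(a <- msupp r) F a r@_a = \sum_(a <- d) F a r@_a.
  by move=> le; rewrite [LHS](big_fset_incl _ le) => //= a _ /mcoeff_outdom ->; rewrite F0.
pose d := (msupp (c *: p + q : lpol n W) `|` (msupp p `|` msupp q))%fset.
rewrite !(widen d) ?fsubsetUl //; last first.
  by apply: (fsubset_trans (fsubsetUl _ (msupp q))); apply: fsubsetUr.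
  by apply: (fsubset_trans (fsubsetUr (msupp p) _)); apply: fsubsetUr.
rewrite scaler_sumr -big_split; apply: eq_bigr => a _ /=.
by rewrite mcoeff_lin hF.
Qed.

Lemma malg_scaleU (I : choiceType) W c (v : W) (a : I) :
  << c%:P *: v *g a >> = malg_scale c << v *g a >>.
Proof. by apply/malgP => b; rewrite malg_scaleE !mcoeffU scalerMnr. Qed.

Lemma monalgU_klinear n W (a : lmon n) :
  klinear (fun w : W => << w *g a >> : lpol n W).
Proof. by move=> c v w; rewrite monalgUD malg_scaleU. Qed.

Lemma lpol_const_klinear n W : klinear (@lpol_const K n W).
Proof. exact: monalgU_klinear. Qed.

Lemma lact_linear n W q : linear (@lact K n W q).
Proof.
move=> c p p'; rewrite lact.unlock scaler_sumr -big_split; apply: eq_bigr => a _ /=.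
apply: (@sum_msupp_linear n W _ (fun b w => << q@_a *: w *g mmul a b >> : lpol n W)).
move=> b d v w; rewrite -[RHS]monalgU_klinear scalerDr !scalerA.
by rewrite [_ * d%:P]mulrC.
Qed.

Lemma lsubst_linear n n' W s : linear (@lsubst K n n' W s).
Proof.
move=> c p q; rewrite lsubst.unlock.
apply: (@sum_msupp_linear n W _ (fun a w =>
  lact (\prod_i s i ^+ (a : {cmonom 'I_n}) i) (lpol_const w))) => a d v w.
by rewrite lpol_const_klinear lact_linear.
Qed.

Lemma lreduce_linear n W : linear (@lreduce K n W).
Proof. exact: lsubst_linear. Qed.

Lemma lext_linear n V W (phi : V -> lpol n W) : klinear phi -> linear (lext phi).
Proof.
move=> h c p q; rewrite lext.unlock.
apply: (@sum_msupp_linear n V _ (fun a v => lact << a >> (phi v))) => a d v w.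
by rewrite h lact_linear.
Qed.

Lemma lext_phi_linear n V W (phi1 phi2 phi : V -> lpol n W) c X :
  (forall v, phi v = c *: phi1 v + phi2 v) ->
  lext phi X = c *: lext phi1 X + lext phi2 X.
Proof.
move=> h; rewrite lext.unlock scaler_sumr -big_split; apply: eq_bigr => a _ /=.
by rewrite h lact_linear.
Qed.

Lemma lmap_linear n V W (phi : V -> W) :
  (forall c v w, phi (c%:P *: v + w) = c%:P *: phi v + phi w) ->
  linear (@lmap K n V W phi).
Proof.
move=> h; apply: lext_linear => c v w.
by rewrite h lpol_const_klinear.
Qed.

Section Product.
Context (n : nat) (V1 V2 W : lmodType {poly K}) (f : lambda_product V1 V2 W).
Context (s : lring K n).

Lemma lprod_linearl Y : (forall y, klinear (f^~ y)) -> linear ((lprod f s)^~ Y).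
Proof.
move=> h; apply: lext_linear => c v w; apply: lext_phi_linear => y.
by rewrite h lsubst_linear.
Qed.

Lemma lprod_linearr X : (forall x, klinear (f x)) -> linear (lprod f s X).
Proof.
move=> h c Y Z; apply: lext_phi_linear => x; apply: lext_linear => {}c v w.
by rewrite h lsubst_linear.
Qed.

End Product.

Definition multilinear m V W (f : cochain m V W) : Prop :=
  forall (x : m.-tuple V) (j : 'I_m), klinear (fun v => f (tupdate x j v)).

Section Slots.
Context (N : nat) (V W : lmodType {poly K}) (x : N.-tuple V).

Lemma consecutive_linear n i :
  linear (fun g : cochain n V W => consecutive x g i).
Proof. by move=> c f g; rewrite /consecutive lsubst_linear. Qed.

Lemma insert_linearl m i w X :
  linear (fun f : cochain m V W => insert x f i w X).
Proof.
by move=> c f g; apply: lext_phi_linear => v; rewrite -lsubst_linear.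
Qed.

Lemma insert_linearr m (f : cochain m V W) i w :
  multilinear f -> (i < m)%N -> linear (insert x f i w).
Proof.
move=> hf im; apply: lext_linear => c v v'.
pose t0 := [tuple splice i w 0 (nth 0 x) k | k < m].
have E u : [tuple splice i w u (nth 0 x) k | k < m] = tupdate t0 (Ordinal im) u.
  apply: eq_mktuple => k; rewrite -val_eqE /= /splice tnth_mktuple /splice.
  by case: ltngtP.
by rewrite !E hf lsubst_linear.
Qed.

End Slots.

Lemma tupdateE N V (x : N.-tuple V) l v k :
  nth 0 (tupdate x l v) k = if k == l then v else nth 0 x k.
Proof.
case: (ltnP k N) => kN.
  rewrite -[k]/(val (Ordinal kN)) -tnth_nth tnth_mktuple -val_eqE /=.
  by case: eqP => // _; rewrite (tnth_nth 0).
rewrite !nth_default ?size_tuple // gtn_eqF //.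
exact: leq_trans (ltn_ord l) kN.
Qed.

Lemma gcirc_multilinear N m n V (f : cochain m V V) (g : cochain n V V) :
  (N <= (m + n).-1)%N -> multilinear f -> multilinear g ->
  multilinear (gcirc N f g).
Proof.
move=> hN hf hg x l c v w; rewrite /gcirc scaler_sumr -big_split.
apply: eq_bigr => i _ /=; rewrite scalerA [c * _]mulrC -scalerA -scalerDr.
congr (_ *: _); rewrite -lreduce_linear; congr lreduce.
case: (boolP ((i <= l) && (l < i + n))%N) => [/andP[il lin]|out].
- have ln : (l - i < n)%N by rewrite ltn_subLR.
  have -> : consecutive (tupdate x l (c%:P *: v + w)) g i
      = c *: consecutive (tupdate x l v) g i + consecutive (tupdate x l w) g i.
    rewrite /consecutive.
    pose t0 := [tuple nth 0 x (i + k) | k < n].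
    have E u : [tuple nth 0 (tupdate x l u) (i + k) | k < n]
        = tupdate t0 (Ordinal ln) u.
      apply: eq_mktuple => k; rewrite tupdateE tnth_mktuple -val_eqE /=.
      by rewrite -{1}(subnKC il) eqn_add2l.
    by rewrite !E hg lsubst_linear.
  have E u X : insert (tupdate x l u) f i n X = insert x f i n X.
    congr lext; apply/funext => z; congr (lsubst _ (f _)).
    apply: eq_mktuple => k; rewrite /splice !tupdateE.
    case: ltngtP => // ki.
      by rewrite ltn_eqF // (leq_trans ki).
    rewrite gtn_eqF // (leq_trans lin) // leq_add2r -ltnS prednK //.
    exact: leq_ltn_trans ki.
  by rewrite !E insert_linearr.
- have E u : consecutive (tupdate x l u) g i = consecutive x g i.
    congr (lsubst _ (g _)); apply: eq_mktuple => k; rewrite tupdateE.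
    case: eqP => // kl; move: out.
    by rewrite -kl leq_addr ltn_add2l ltn_ord.
  rewrite !E; apply: lext_phi_linear => z; rewrite -lsubst_linear; congr lsubst.
  have [l' hl'] : exists l' : 'I_m, forall u k, (k < m)%N ->
      splice i n z (nth 0 (tupdate x l u)) k
      = if k == l' then u else splice i n z (nth 0 x) k.
    case: (ltnP l i) => li.
      exists (Ordinal (ltn_trans li (ltn_ord i))) => u k _ /=.
      rewrite /splice !tupdateE; case: ltngtP => ki.
      - by [].
      - rewrite gtn_eqF; last first.
          by rewrite (leq_trans li) // (leq_trans _ (leq_addr _ _)) // -ltnS prednK // (leq_ltn_trans _ ki).
        by rewrite gtn_eqF // (ltn_trans li).
      - by rewrite ki gtn_eqF.
    have lin : (i + n <= l)%N by move: out; rewrite li /= -leqNgt.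
    have nl : (n <= l)%N by exact: leq_trans (leq_addl _ _) lin.
    have lm : ((l - n).+1 < m)%N.
      have := leq_trans (ltn_ord l) hN.
      by rewrite ltn_predRL -subSn // ltn_subLR 1?addnC // leqW.
    exists (Ordinal lm) => u k _ /=; rewrite /splice !tupdateE.
    have il' : (i <= l - n)%N by rewrite leq_subRL // addnC.
    case: ltngtP => ki.
    - rewrite ltn_eqF ?(leq_trans ki) // ltn_eqF // ltnS.
      exact: leq_trans (ltnW ki) il'.
    - case: k ki => // k ki; rewrite eqSS /=.
      by rewrite -(eqn_add2r n k) subnK.
    - by rewrite ki ltn_eqF.
  have E' u : [tuple splice i n z (nth 0 (tupdate x l u)) k | k < m]
     = tupdate [tuple splice i n z (nth 0 x) k | k < m] l' u.
    by apply: eq_mktuple => k; rewrite hl' // tnth_mktuple.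
  by rewrite !E' hf.
Qed.

Lemma multilinear_comb m V W (f g : cochain m V W) c :
  multilinear f -> multilinear g -> multilinear (c *: f + g).
Proof.
move=> hf hg x j d v w; rewrite -[LHS]/(c *: f _ + g _) -[RHS]/(_ *: (c *: f _ + g _) + (c *: f _ + g _)).
by rewrite hf hg !scalerDr !scalerA [c * d]mulrC addrACA.
Qed.

End Linearity.

Section DifferentialLinearity.
Context {K : fieldType}.
Implicit Types V W : lmodType {poly K}.

Lemma cochainP m V W (f g : cochain m V W) c x : (c *: f + g) x = c *: f x + g x.
Proof. by []. Qed.

Lemma sum_linear (I : finType) (A B : lmodType K) (F : I -> A -> B) :
  (forall i, linear (F i)) -> linear (fun x => \sum_i F i x).
Proof. 
by move=> h c x y; rewrite scaler_sumr -big_split; apply: eq_bigr => i _ /=; rewrite h.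
Qed.

Lemma scale_linear (A B : lmodType K) (F : A -> B) e :
  linear F -> linear (fun x => e *: F x).
Proof. by move=> h c x y; rewrite h scalerDr !scalerA mulrC. Qed.

Lemma add_linear (A B : lmodType K) (F G : A -> B) :
  linear F -> linear G -> linear (fun x => F x + G x).
Proof. by move=> hF hG c x y; rewrite hF hG scalerDr addrACA. Qed.

Lemma opp_linear (A B : lmodType K) (F : A -> B) :
  linear F -> linear (fun x => - F x).
Proof. by move=> hF c x y; rewrite hF opprD scalerN. Qed.

Lemma comp_linear (A B C : lmodType K) (F : B -> C) (G : A -> B) :
  linear F -> linear G -> linear (fun x => F (G x)).
Proof. by move=> hF hG c x y; rewrite hG hF. Qed.

Lemma fun_linear (A : lmodType K) m V W (F : A -> cochain m V W) :
  (forall x, linear (F^~ x)) -> linear F.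
Proof. by move=> h c f g; apply/funext => x; rewrite h. Qed.

Lemma gcirc_linearl N m n V (g : cochain n V V) :
  linear (fun f : cochain m V V => gcirc N f g).
Proof.
apply: fun_linear => x; apply: sum_linear => i; apply: scale_linear.
refine (comp_linear (@lreduce_linear _ _ _) (insert_linearl x _ _ _)).
Qed.

Lemma gcirc_linearr N m n V (f : cochain m V V) : multilinear f ->
  linear (fun g : cochain n V V => gcirc N f g).
Proof.
move=> hf; apply: fun_linear => x; apply: sum_linear => i; apply: scale_linear.
refine (comp_linear (@lreduce_linear _ _ _) _).
refine (comp_linear (insert_linearr x n hf (ltn_ord i)) (consecutive_linear x i)).
Qed.

Lemma gbracket_linearr m n V (f : cochain m V V) : multilinear f ->
  linear (@gbracket K m n V f).
Proof.
move=> hf; apply: add_linear; first exact: gcirc_linearr.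
apply: opp_linear; apply: scale_linear; exact: gcirc_linearl.
Qed.

Lemma gbracket_multilinear m n V (f : cochain m V V) (g : cochain n V V) :
  multilinear f -> multilinear g -> multilinear (gbracket f g).
Proof.
move=> hf hg; rewrite /gbracket -scaleN1r addrC scalerA.
by apply: multilinear_comb; apply: gcirc_multilinear; rewrite // addnC.
Qed.

Section Operator.
Context (T : conf_algebra K) (U : conf_bimodule T) (H : cocycle2 U).
Context (R : {linear U -> T}).
Local Notation TU := (T * U)%type.

Lemma semidirect_multilinear : multilinear (@semidirect K T U).
Proof.
have [ml mr _ _] := cmul_sesquilinear T.
have [ll lr _ _] := @lmul_sesquilinear _ _ U.
have [rl rr _ _] := @rmul_sesquilinear _ _ U.
have lin1 : linear (@lmap K 1 T TU (fun t : T => (t, 0) : TU)).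
  apply: lmap_linear => c v w; congr pair; by rewrite /= scaler0 addr0.
have lin2 : linear (@lmap K 1 U TU (fun t : U => (0, t) : TU)).
  apply: lmap_linear => c v w; congr pair; by rewrite /= scaler0 addr0.
move=> x j c [p u] [q v]; rewrite /semidirect.
rewrite !tnth_mktuple; case: (tnth x 0) (tnth x 1) => [x1 x2] [x3 x4].
have regroup (a1 b1 a2 b2 : lpol 1 U) :
    c *: a1 + b1 + (c *: a2 + b2) = c *: (a1 + a2) + (b1 + b2).
  by rewrite scalerDr addrACA.
case: j => [[|[|//]] jm] /=.
  by rewrite ml ll rl lin1 regroup lin2 scalerDr addrACA.
by rewrite mr lr rr lin1 regroup lin2 scalerDr addrACA.
Qed.

Lemma extend_linear m : linear (@extend K T U m).
Proof.
apply: fun_linear => x c f g; rewrite /extend cochainP lmap_linear //.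
by move=> d v w; congr pair; rewrite /= scaler0 addr0.
Qed.

Lemma extend_multilinear m (g : cochain m U T) : multilinear g -> multilinear (extend g).
Proof.
move=> hg x j c v w; rewrite /extend.
have E u : [tuple (tnth (tupdate x j u) k).2 | k < m]
    = tupdate [tuple (tnth x k).2 | k < m] j u.2.
  by apply: eq_mktuple => k; rewrite !tnth_mktuple; case: ifP.
rewrite !E hg lmap_linear //.
by move=> d t t'; congr pair; rewrite /= scaler0 addr0.
Qed.

Lemma restrict_linear m : linear (@restrict K T U m).
Proof. by apply: fun_linear => x c f g; rewrite /restrict cochainP lmap_linear. Qed.

Lemma cochain1_multilinear : multilinear (cochain1 R).
Proof.
move=> x j c v w; rewrite /cochain1 !tnth_mktuple.
case: j => [[|//] jm] /=.
by rewrite linearP lpol_const_klinear.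
Qed.

Lemma bracket2_linear a b (A : cochain a U T) : multilinear A ->
  linear (@bracket2 K T U a b A).
Proof.
move=> hA; apply: scale_linear; refine (comp_linear (@restrict_linear _) _).
refine (comp_linear (gbracket_linearr (f := gbracket (@semidirect K T U) (extend A)) _) (@extend_linear _)).
apply: gbracket_multilinear; first exact: semidirect_multilinear.
exact: extend_multilinear.
Qed.

Lemma plug_linear1 N a b c (B : cochain b U T) (C : cochain c U T) :
  linear (fun A : cochain a U T => plug H N A B C).
Proof.
apply: fun_linear => x; apply: sum_linear => i; apply: scale_linear.
refine (comp_linear (@lreduce_linear _ _ _) (insert_linearl x _ _ _)).
Qed.

Lemma plug_linear2 N a b c (A : cochain a U T) (C : cochain c U T) :
  multilinear A -> linear (fun B : cochain b U T => plug H N A B C).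
Proof.
move=> hA; apply: fun_linear => x; apply: sum_linear => i; apply: scale_linear.
refine (comp_linear (@lreduce_linear _ _ _) _).
refine (comp_linear (insert_linearr x _ hA (ltn_ord i)) _).
have [hl _ _ _] := cocycle_sesquilinear H.
refine (comp_linear (lprod_linearl _ _ _) (consecutive_linear x _)); move=> y d v w.
exact: hl.
Qed.

Lemma plug_linear3 N a b c (A : cochain a U T) (B : cochain b U T) :
  multilinear A -> linear (fun C : cochain c U T => plug H N A B C).
Proof.
move=> hA; apply: fun_linear => x; apply: sum_linear => i; apply: scale_linear.
refine (comp_linear (@lreduce_linear _ _ _) _).
refine (comp_linear (insert_linearr x _ hA (ltn_ord i)) _).
have [_ hr _ _] := cocycle_sesquilinear H.
refine (comp_linear (lprod_linearr _ _ _) (consecutive_linear x _)); move=> y d v w.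
exact: hr.
Qed.

Lemma bracket3_linear a b c (A : cochain a U T) (B : cochain b U T) :
  multilinear A -> multilinear B -> linear (@bracket3 K T U H a b c A B).
Proof.
move=> hA hB; apply: scale_linear.
by do ![apply: add_linear | apply: opp_linear | apply: scale_linear];
   [apply: plug_linear3|apply: plug_linear2|apply: plug_linear3|apply: plug_linear2|apply: plug_linear1|apply: plug_linear1].
Qed.

Fact d_RB_linear m : linear (@d_RB K T U H R m).
Proof.
apply: add_linear; first exact: bracket2_linear cochain1_multilinear.
apply: opp_linear; apply: scale_linear.
exact: (@bracket3_linear 1 1 m _ _ cochain1_multilinear cochain1_multilinear).
Qed.

Lemma lmapR_linear n : linear (@lmap K n U T R).
Proof. by apply: lmap_linear => c v w; rewrite linearP. Qed.

Fact d_Hoch_linear m : linear (d_Hoch (induced_mul H R) (induced_lact H R) (induced_ract H R) (m := m)).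
Proof.
have [ml mr _ _] := cmul_sesquilinear T.
have [ll lr _ _] := @lmul_sesquilinear _ _ U.
have [rl rr _ _] := @rmul_sesquilinear _ _ U.
have [hl hr _ _] := cocycle_sesquilinear H.
apply: fun_linear => x; refine (comp_linear (@lreduce_linear _ _ _) _).
apply: add_linear; first apply: add_linear.
- refine (comp_linear (lprod_linearr _ _ _) (consecutive_linear x _)); move=> u c p q.
  rewrite /induced_lact mr rr hr addrACA -scalerDr lmapR_linear scalerBr.
  by rewrite opprD addrACA.
- by apply: sum_linear => j; apply: scale_linear; apply: insert_linearl.
- apply: scale_linear; refine (comp_linear (lprod_linearl _ _ _) (consecutive_linear x _)).
  move=> u c p q.
  rewrite /induced_ract ml ll hl addrACA -scalerDr lmapR_linear scalerBr.
  by rewrite opprD addrACA.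
Qed.

End Operator.
End DifferentialLinearity.

Section Cohomology.
Context {K : fieldType}.

Record subspace (V : lmodType K) := Subspace {
  subspace_pred :> {pred V};
  subspace_closed : submod_closed subspace_pred }.

HB.instance Definition _ (V : lmodType K) (S : subspace V) :=
  GRing.isSubmodClosed.Build K V (subspace_pred S) (subspace_closed S).

Definition carrier (V : lmodType K) (S : subspace V) : Type :=
  {x : V | x \in subspace_pred S}.

HB.instance Definition _ (V : lmodType K) (S : subspace V) :=
  SubChoice.copy (carrier S) {x : V | x \in subspace_pred S}.
HB.instance Definition _ (V : lmodType K) (S : subspace V) :=
  [SubChoice_isSubLmodule of carrier S by <:].

Definition quotient (V : lmodType K) (B : subspace V) : Type :=
  Quotient.quot (subspace_pred B).

HB.instance Definition _ (V : lmodType K) (B : subspace V) :=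
  GRing.Zmodule.copy (quotient B) (Quotient.quot (subspace_pred B)).

Section QuotientScaling.
Context (V : lmodType K) (B : subspace V).
Local Notation Q := (Quotient.quot (subspace_pred B)).

Definition quotient_scale (c : K) (q : Q) : Q := \pi_Q (c *: repr q).

Fact quotient_scale_pi c v : quotient_scale c (\pi_Q v) = \pi_Q (c *: v).
Proof.
apply/eqP; rewrite -Quotient.idealrBE -scalerBr rpredZ //.
by rewrite Quotient.idealrBE reprK.
Qed.

Fact quotient_scaleA c d q :
  quotient_scale c (quotient_scale d q) = quotient_scale (c * d) q.
Proof. by elim/quotW: q => v; rewrite (quotient_scale_pi d) !quotient_scale_pi scalerA. Qed.

Fact quotient_scale1 : left_id 1 quotient_scale.
Proof. by elim/quotW => v; rewrite quotient_scale_pi scale1r. Qed.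

Fact quotient_scaleDr : right_distributive quotient_scale +%R.
Proof.
move=> c; elim/quotW => v; elim/quotW => w.
by rewrite -raddfD !quotient_scale_pi -raddfD scalerDr.
Qed.

Fact quotient_scaleDl q : {morph quotient_scale^~ q : c d / c + d}.
Proof.
by elim/quotW: q => v c d; rewrite !quotient_scale_pi -raddfD scalerDl.
Qed.

HB.instance Definition _ := GRing.Zmodule_isLmodule.Build K (quotient B)
  quotient_scaleA quotient_scale1 quotient_scaleDr quotient_scaleDl.
End QuotientScaling.

Section Complex.
Context (X : nat -> lmodType K) (C : forall m, subspace (X m)).
Context (d : forall m, {linear X m -> X m.+1}).

Definition in_cocycles m : {pred X m} := [pred g | (g \in C m) && (d m g == 0)].

Fact in_cocycles_closed m : submod_closed (@in_cocycles m).
Proof.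
split=> [|c g h]; rewrite !inE ?rpred0 ?linear0 ?eqxx //.
move=> /andP[Cg /eqP dg] /andP[Ch /eqP dh].
by rewrite rpredD ?rpredZ //= linearP dg dh scaler0 addr0.
Qed.

Definition cocycles m : subspace (X m) := Subspace (in_cocycles_closed m).

Definition in_coboundaries m : {pred X m} :=
  match m with
  | 0 => pred1 0
  | m'.+1 => [pred g | `[< exists2 h, h \in C m' & g = d m' h >]]
  end.

(* 'B^m', as a subspace of 'Z^m': one has B^m <= Z^m as soon as d \o d = 0. *)
Fact coboundaries_closed m :
  submod_closed [pred z : carrier (cocycles m) | val z \in @in_coboundaries m].
Proof.
case: m => [|m]; (split=> [|c g h]; rewrite !inE /=).
- exact: eqxx.
- by move=> /eqP-> /eqP->; rewrite scaler0 addr0.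
- by apply/asboolP; exists 0; rewrite ?rpred0 ?linear0.
- move=> /asboolP[g' Cg gE] /asboolP[h' Ch hE]; apply/asboolP.
  by exists (c *: g' + h'); rewrite ?rpredD ?rpredZ // linearP -gE -hE.
Qed.

Definition cohomology m : lmodType K := quotient (Subspace (coboundaries_closed m)).

End Complex.
End Cohomology.

Section HomSpaces.
Context {K : fieldType}.
Implicit Types V W : lmodType {poly K}.

Fact is_Hom_closed m V W :
  submod_closed [pred f : cochain m V W | `[< is_Hom f >]].
Proof.
split=> [|c f g]; rewrite !inE.
  apply/asboolP; have lact0 n q : lact q (0 : lpol n W) = 0.
    exact: (raddf0 (HB.pack (lact q) (GRing.isLinear.Build _ _ _ _ _ (@lact_linear _ n W q)) : {linear _ -> _})).
  split=> * //; rewrite /= ?lact0 //.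
  by rewrite -[RHS]/(_ *: 0 + 0) scaler0 addr0.
move=> /asboolP[f1 f2 f3] /asboolP[g1 g2 g3]; apply/asboolP; split.
- exact: multilinear_comb.
- by move=> x j v jm; rewrite !cochainP lact_linear f2 // g2.
- by move=> x j v jm; rewrite !cochainP lact_linear f3 // g3.
Qed.

(* Hom(V^{⊗m}, W); [lpol 0 W] is W, so that Hom(V^{⊗0}, W) = W. *)
Definition Hom m V W : subspace (cochain m V W) := Subspace (@is_Hom_closed m V W).

End HomSpaces.

Section Cohomologies.
Context {K : fieldType} (T : conf_algebra K) (U : conf_bimodule T).
Context (H : cocycle2 U) (R : twisted_RB H).

HB.instance Definition _ m :=
  GRing.isLinear.Build K (cochain m U T) (cochain m.+1 U T) _
    (d_RB H R (m := m)) (@d_RB_linear _ _ _ H R m).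

Definition RB_cohomology : nat -> lmodType K :=
  cohomology (fun m => Hom m U T) (fun m => d_RB H R (m := m)).

Definition d_Hoch_induced m : cochain m U T -> cochain m.+1 U T :=
  d_Hoch (induced_mul H R) (induced_lact H R) (induced_ract H R) (m := m).

HB.instance Definition _ m :=
  GRing.isLinear.Build K (cochain m U T) (cochain m.+1 U T) _
    (@d_Hoch_induced m) (@d_Hoch_linear _ _ _ H R m).

Definition Hoch_cohomology : nat -> lmodType K :=
  cohomology (fun m => Hom m U T) (@d_Hoch_induced).

End Cohomologies.

(* Main.v *)
Require Import Defs.
From HB Require Import structures.
From mathcomp Require Import all_boot all_order all_algebra.
From mathcomp Require Import boolp functions finmap monalg reals complex.
Import GRing.Theory.
Local Open Scope ring_scope.
Set Implicit Arguments.
Unset Strict Implicit.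
Unset Printing Implicit Defensive.

(* On multilinear m-cochains, d_R = (-1)^m δ_Hoch, so the two complexes have the
   same cocycles and coboundaries and the identity induces the isomorphism. The
   derived bracket gives the part of δ_Hoch without H: the Gerstenhaber bracket
   [π, R]_G packages both untwisted actions R(u)p - R(up), pR(u) - R(pu) and the
   product uR(v) + R(u)v. The six terms of the ternary bracket at (R, R, g)
   coincide in pairs, which the factor 1/2 compensates, and they are the
   H-terms of δ_Hoch. *)

(** * Calculus of λ-polynomials: evaluation on monomials and naturality of coefficientwise maps *)

Lemma monalgUM (M : conomType) (R : comNzRingType) (a b : M) :
  << a >> * << b >> = << mmul a b >> :> {malg R[M]}.
Proof. by rewrite malgM_def fgmulUU mulr1. Qed.

Section LambdaCalculus.
Context {K : fieldType}.
Implicit Types V W : lmodType {poly K}.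

Lemma sum_msuppU n (V M : zmodType) (F : lmon n -> V -> M) v b : F b 0 = 0 ->
  \sum_(a <- msupp << v *g b >>) F a << v *g b >>@_a = F b v.
Proof.
(* For [v = 0] the monomial has empty support; [F b 0 = 0] makes the two sides agree there. *)
move=> F0; rewrite msuppU; case: eqP => [->|_].
  by rewrite big_seq_fset0 F0.
by rewrite big_seq_fset1 mcoeffUU.
Qed.

(** A λ-polynomial is the sum of its monomials, so linearity over [K] reduces an identity between
    maps to monomials. Most identities of this section are proved this way. *)
Lemma lpol_linear_ext n V (M : lmodType K) (F G : lpol n V -> M) :
  linear F -> linear G -> (forall v a, F << v *g a >> = G << v *g a >>) -> F =1 G.
Proof.
move=> linF linG FG p.
have morph E : linear E ->
    E p = \sum_(a <- msupp p) E << p@_a *g a >> :> M.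
  move=> linE; rewrite {1}(monalgE p).
  pose E' : {linear lpol n V -> M} := HB.pack E (GRing.isLinear.Build _ _ _ _ _ linE).
  exact: (raddf_sum E').
by rewrite !morph //; apply: eq_bigr.
Qed.

Lemma lactU n W c (a : lmon n) (w : W) b :
  lact << c *g a >> << w *g b >> = << c *: w *g mmul a b >> :> lpol n W.
Proof.
rewrite lact.unlock.
rewrite (@sum_msuppU n {poly K} _ (fun a' c' =>
  \sum_(b' <- msupp << w *g b >>) << c' *: << w *g b >>@_b' *g mmul a' b' >>)).
  by rewrite (@sum_msuppU n W _ (fun b' w' => << _ *: w' *g mmul _ b' >>)) // scaler0 monalgU0.
by rewrite big1 // => b' _; rewrite scale0r monalgU0.
Qed.

Lemma lact1 n W : @lact K n W 1 =1 id.
Proof.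
apply: lpol_linear_ext => // [|w b]; first exact: lact_linear.
by rewrite -mpolyC1E lactU scale1r mul1m.
Qed.

Lemma lpol_linear0 n n' V W (F : lpol n V -> lpol n' W) : linear F -> F 0 = 0.
Proof. by move=> h; have := h (-1) 0 0; rewrite scaler0 addr0 scaleN1r addNr. Qed.

Lemma lsubstU n n' W (s : 'I_n -> lring K n') (w : W) a :
  lsubst s << w *g a >>
  = lact (\prod_i s i ^+ (a : {cmonom 'I_n}) i) (lpol_const w).
Proof.
rewrite lsubst.unlock.
apply: (@sum_msuppU n W _ (fun a w =>
  lact (\prod_i s i ^+ (a : {cmonom 'I_n}) i) (lpol_const w))).
rewrite /lpol_const monalgU0.
exact: lpol_linear0 (@lact_linear _ n' W _).
Qed.

Lemma lextU n V W (F : V -> lpol n W) v a : klinear F ->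
  lext F << v *g a >> = lact << a >> (F v).
Proof.
move=> linF; rewrite lext.unlock.
apply: (@sum_msuppU n V _ (fun a v => lact << a >> (F v))).
by rewrite klinear0 //; exact: lpol_linear0 (@lact_linear _ n W _).
Qed.

Lemma lext_const n V W (F : V -> lpol n W) v : klinear F ->
  lext F (lpol_const v) = F v.
Proof. by move=> linF; rewrite lextU // (mpolyC1E (lmon n) {poly K}) lact1. Qed.

Lemma lsubst_const n n' W (s : 'I_n -> lring K n') (w : W) :
  lsubst s (lpol_const w) = lpol_const w.
Proof. by rewrite lsubstU big1 ?lact1 // => i _; rewrite (cm1 i). Qed.

Section Naturality.
Context (n : nat) (V W : lmodType {poly K}) (phi : V -> W) (linphi : linear phi).

Lemma linear_klinear : klinear (fun v => lpol_const (phi v) : lpol n W).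
Proof. by move=> c v w; rewrite linphi lpol_const_klinear. Qed.

Lemma lmapU v a : lmap phi << v *g a >> = << phi v *g a >> :> lpol n W.
Proof. by rewrite /lmap lextU ?lactU ?scale1r ?mulm1 //; exact: linear_klinear. Qed.

Lemma lmap_lpol_linear : linear (@lmap K n V W phi).
Proof. by apply: lmap_linear => c; exact: linphi. Qed.

Lemma lmap_const v : lmap phi (lpol_const v) = lpol_const (phi v) :> lpol n W.
Proof. exact: lmapU. Qed.

End Naturality.

Lemma lact_suml n W (I : Type) (r : seq I) (F : I -> lring K n) (p : lpol n W) :
  lact (\sum_(i <- r) F i) p = \sum_(i <- r) lact (F i) p.
Proof.
(* The ring [lring K n] is read as λ-polynomials over the regular module [{poly K}^o], so that
   [sum_msupp_linear] applies to the acting argument. *)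
have lin : linear (fun q : lpol n {poly K}^o => lact q p : lpol n W).
  rewrite lact.unlock; apply: (sum_msupp_linear (W := {poly K}^o)
    (F := fun a c => \sum_(b <- msupp p) << c *: p@_b *g mmul a b >> : lpol n W)).
  move=> a c v w; rewrite scaler_sumr -big_split; apply: eq_bigr => b _ /=.
  by rewrite scalerDl -scalerA monalgU_klinear.
pose G : {linear lpol n {poly K}^o -> lpol n W} :=
  HB.pack (fun q : lpol n {poly K}^o => lact q p : lpol n W)
    (GRing.isLinear.Build _ _ _ _ _ lin).
exact: (raddf_sum G).
Qed.

(** The coefficients of [q] are polynomials in ∂, and [phi] commutes with them because [linear phi]
    is linearity over [{poly K}]. *)
Lemma lmap_lact n V W (phi : V -> W) q (p : lpol n V) : linear phi ->
  lmap phi (lact q p) = lact q (lmap phi p).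
Proof.
move=> linphi; move: p; apply: lpol_linear_ext => [c p p'|c p p'|v b].
- by rewrite lact_linear lmap_lpol_linear.
- by rewrite lmap_lpol_linear // lact_linear.
rewrite (lmapU linphi) (monalgE q) !lact_suml.
elim/big_ind2: _ => [|x1 x2 y1 y2 <- <-|a _].
- by rewrite (lpol_linear0 (lmap_lpol_linear linphi)).
- by have := lmap_lpol_linear linphi 1 x2 y2; rewrite !scale1r.
have phiZ c : phi (c *: v) = c *: phi v.
  have := linphi c v 0; have := linphi (-1) 0 0.
  by rewrite !(scaler0, addr0) scaleN1r addNr => -> /[!addr0].
by rewrite lactU lactU (lmapU linphi) phiZ.
Qed.

(** The substituted values may contain ∂, with which [phi] commutes. In particular [R], the
    inclusions into [T * U] and the projections from it pass through [lreduce]. *)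
Lemma lmap_lsubst n n' V W (phi : V -> W) (s : 'I_n -> lring K n') (p : lpol n V) :
  linear phi -> lmap phi (lsubst s p) = lsubst s (lmap phi p).
Proof.
move=> linphi; move: p; apply: lpol_linear_ext => [c p p'|c p p'|v b].
- by rewrite lsubst_linear lmap_lpol_linear.
- by rewrite lmap_lpol_linear // lsubst_linear.
by rewrite (lmapU linphi) lsubstU lsubstU (lmap_lact _ _ linphi) (lmap_const _ linphi).
Qed.

Lemma lmap_lext n V W W' (phi : W -> W') (F : V -> lpol n W) (X : lpol n V) :
  linear phi -> klinear F -> lmap phi (lext F X) = lext (fun v => lmap phi (F v)) X.
Proof.
move=> linphi linF.
have linG : klinear (fun v => lmap phi (F v)).
  by move=> c v w; rewrite linF lmap_lpol_linear.
move: X; apply: lpol_linear_ext => [c p p'|c p p'|v b].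
- by rewrite lext_linear // lmap_lpol_linear.
- exact: lext_linear.
by rewrite (lextU _ _ linF) (lextU _ _ linG) lmap_lact.
Qed.

Lemma lext_lmap n V V' W (phi : V -> V') (F : V' -> lpol n W) (X : lpol n V) :
  linear phi -> klinear F -> lext F (lmap phi X) = lext (fun v => F (phi v)) X.
Proof.
move=> linphi linF.
have linG : klinear (fun v => F (phi v)) by move=> c v w; rewrite linphi linF.
move: X; apply: lpol_linear_ext => [c p p'|c p p'|v b].
- by rewrite lmap_lpol_linear // lext_linear.
- exact: lext_linear.
by rewrite (lmapU linphi) (lextU _ _ linF) (lextU _ _ linG).
Qed.

Lemma lmap_zero n V W (X : lpol n V) :
  lmap (fun=> 0 : W) X = 0.
Proof.
have lin0 : linear (fun=> 0 : W) by move=> V' c v w; rewrite scaler0 addr0.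
move: X; apply: lpol_linear_ext => [|c p q|v a].
- exact: lmap_lpol_linear.
- by rewrite scaler0 addr0.
- by rewrite lmapU // monalgU0.
Qed.

Lemma lmapD n (V W : lmodType {poly K}) (phi : V -> W) : linear phi ->
  {morph (@lmap K n V W phi) : X Y / X + Y}.
Proof.
by move=> linphi X Y; have := lmap_lpol_linear (n := n) linphi 1 X Y; rewrite !scale1r.
Qed.

Lemma lmapN n (V W : lmodType {poly K}) (phi : V -> W) : linear phi ->
  {morph (@lmap K n V W phi) : X / - X}.
Proof.
move=> linphi X; have := lmap_lpol_linear (n := n) linphi (-1) X 0.
by rewrite (lpol_linear0 (lmap_lpol_linear linphi)) !addr0 !scaleN1r.
Qed.

Lemma lmapZ n (V W : lmodType {poly K}) (phi : V -> W) c (X : lpol n V) :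
  linear phi -> lmap phi (c *: X) = c *: lmap phi X.
Proof.
move=> linphi; have := lmap_lpol_linear (n := n) linphi c X 0.
by rewrite (lpol_linear0 (lmap_lpol_linear linphi)) !addr0.
Qed.

Lemma lmap_sum n (V W : lmodType {poly K}) (phi : V -> W) (I : finType)
  (F : I -> lpol n V) : linear phi -> lmap phi (\sum_i F i) = \sum_i lmap phi (F i).
Proof.
move=> linphi.
apply: (big_morph _ (lmapD linphi)); exact: (lpol_linear0 (lmap_lpol_linear linphi)).
Qed.

Lemma lmap_comp n V V' W (phi : V -> V') (psi : V' -> W) (X : lpol n V) :
  linear phi -> linear psi -> lmap psi (lmap phi X) = lmap (fun v => psi (phi v)) X.
Proof.
by move=> linphi linpsi; apply: lext_lmap => //; apply: linear_klinear.
Qed.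

Lemma lmap_id n V (X : lpol n V) : lmap id X = X.
Proof.
move: X; apply: lpol_linear_ext => [|//|v b]; first exact: lmap_lpol_linear.
by rewrite lmapU.
Qed.

Lemma lvarX n (i : 'I_n) k : exists2 b : {cmonom 'I_n},
  lvar n i ^+ k = << b >> :> lring K n & forall j, b j = ((i == j) * k)%N.
Proof.
elim: k => [|k [b eb hb]].
  by exists mone => [|j]; rewrite ?muln0 ?cm1 // expr0 -mpolyC1E.
exists (mmul (ucm i) b) => [|j].
  by rewrite exprS eb /lvar valK; exact: monalgUM.
by rewrite cmM cmU hb mulnS.
Qed.

(** For two arguments [lreduce] keeps λ_1 and replaces only λ_2, which does not occur here. This
    turns a composition computed with two variables back into an ordinary λ-product. *)
Lemma lreduce_lambda0 W (p : lpol 1 W) : lreduce (lsubst (fun=> lvar 2 0) p) = p.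
Proof.
move: p; apply: lpol_linear_ext => [c p p'|//|w a].
  by rewrite lsubst_linear lreduce_linear.
(* [b] and [b'] are the same power of λ_1, as monomials in two variables and in one. As [b] has
   exponent 0 in λ_2, the value substituted for λ_2 contributes a factor 1. *)
have [b eb hb] := lvarX (ord0 : 'I_2) (a (ord0 : 'I_1)).
have [b' eb' hb'] := lvarX (ord0 : 'I_1) (a (ord0 : 'I_1)).
rewrite lsubstU big_ord1 eb lactU scale1r mulm1 /lreduce lsubstU.
rewrite big_ord_recl !big_ord1 /= !hb /= mul1n mul0n expr0 mulr1 eb' lactU scale1r.
have -> : b' = a by apply/eqP/cmP => j; rewrite (ord1 j) hb' mul1n.
rewrite mulm1; reflexivity.
Qed.

Lemma lreduceD n W : {morph (@lreduce K n W) : X Y / X + Y}.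
Proof. by move=> X Y; have := @lreduce_linear K n W 1 X Y; rewrite !scale1r. Qed.

Lemma lreduce0 n W : @lreduce K n W 0 = 0.
Proof. exact: (lpol_linear0 (@lreduce_linear K n W)). Qed.

Lemma lreduceZ n W c (X : lpol n W) : lreduce (c *: X) = c *: lreduce X.
Proof. by have := @lreduce_linear K n W c X 0; rewrite lreduce0 !addr0. Qed.

Lemma lreduceB n W : {morph (@lreduce K n W) : X Y / X - Y}.
Proof. by move=> X Y; rewrite -scaleN1r lreduceD lreduceZ scaleN1r. Qed.

End LambdaCalculus.

(** * Insertion and composition for cochains of arity one and two *)

Section Slots.
Context {K : fieldType}.
Implicit Types V W : lmodType {poly K}.

Lemma lsubst_klinear n n' V W (s : 'I_n -> lring K n') (F : V -> lpol n W) :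
  klinear F -> klinear (fun v => lsubst s (F v)).
Proof. by move=> linF c v w; rewrite linF lsubst_linear. Qed.

Lemma klinear_comb n V W (phi1 phi2 : V -> lpol n W) a :
  klinear phi1 -> klinear phi2 -> klinear (fun v => a *: phi1 v + phi2 v).
Proof.
move=> lin1 lin2 c v w.
by rewrite lin1 lin2 !scalerDr !scalerA [a * c]mulrC addrACA.
Qed.

Lemma klinear_comp n V V' W (phi : V -> V') (F : V' -> lpol n W) :
  linear phi -> klinear F -> klinear (fun v => F (phi v)).
Proof. by move=> linphi linF c v w; rewrite linphi linF. Qed.

Lemma lsubst_var1 n W (s : 'I_1 -> lring K n) (p : lpol 1 W) :
  lsubst s p = lsubst (fun=> s ord0) p.
Proof. by congr lsubst; apply/funext => k; rewrite ord1. Qed.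

Lemma lprod_constl n V1 V2 W (f : lambda_product V1 V2 W) (s : lring K n) x Y :
  (forall y, klinear (f^~ y)) ->
  lprod f s (lpol_const x) Y = lext (fun y => lsubst (fun=> s) (f x y)) Y.
Proof.
move=> linf; rewrite /lprod lext_const // => c v w.
by apply: lext_phi_linear => y; rewrite linf lsubst_linear.
Qed.

Lemma lprod_constr n V1 V2 W (f : lambda_product V1 V2 W) (s : lring K n) X y :
  (forall x, klinear (f x)) ->
  lprod f s X (lpol_const y) = lext (fun x => lsubst (fun=> s) (f x y)) X.
Proof.
move=> linf; rewrite /lprod; congr lext; apply/funext => x.
by rewrite lext_const //; exact: lsubst_klinear.
Qed.

Lemma lprod_const n V1 V2 W (f : lambda_product V1 V2 W) (s : lring K n) x y :
  (forall y, klinear (f^~ y)) -> (forall x, klinear (f x)) ->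
  lprod f s (lpol_const x) (lpol_const y) = lsubst (fun=> s) (f x y).
Proof.
move=> linl linr; rewrite lprod_constl // lext_const //; exact: lsubst_klinear.
Qed.

Lemma insert_const N V W (x : N.-tuple V) (phi : V -> W) (f : cochain 1 V W) w X :
  (forall y, f y = lpol_const (phi (tnth y 0))) ->
  insert x f 0 w X = lmap phi X.
Proof.
move=> fE; rewrite /insert /lmap; congr lext; apply/funext => v.
by rewrite fE lsubst_const tnth_mktuple.
Qed.

Lemma consecutive_const N V W (x : N.-tuple V) (phi : V -> W) (f : cochain 1 V W) i :
  (forall y, f y = lpol_const (phi (tnth y 0))) ->
  consecutive x f i = lpol_const (phi (nth 0 x i)).
Proof. by move=> fE; rewrite /consecutive fE lsubst_const tnth_mktuple addn0. Qed.

(** The entries of the spliced tuple outside slot [i] do not involve [u], so varying [u] is a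
    [tupdate] of one fixed tuple. *)
Lemma splice_klinear m n V W (g : cochain m V W) (s : 'I_m.-1 -> lring K n) i w y :
  multilinear g -> (i < m)%N ->
  klinear (fun u => lsubst s (g [tuple splice i w u y k | k < m])).
Proof.
move=> ling im; apply: lsubst_klinear => c v v'.
pose t := [tuple splice i w 0 y k | k < m].
have E u : [tuple splice i w u y k | k < m] = tupdate t (Ordinal im) u.
  apply: eq_mktuple => k; rewrite -val_eqE /= /splice tnth_mktuple /splice.
  by case: ltngtP.
rewrite !E; exact: ling.
Qed.

Lemma insert_binary0 N V W (x : N.-tuple V) (f : cochain 2 V W) w X :
  insert x f 0 w X
  = lext (fun v => lsubst (fun=> \sum_(0 <= l < w) lvar N l) (f [tuple v; nth 0 x w])) X.
Proof.
rewrite /insert; congr lext; apply/funext => v; rewrite lsubst_var1 /=.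
congr (lsubst _ (f _)); apply: eq_from_tnth => -[[|[|//]] k2].
  by rewrite tnth_mktuple.
by rewrite tnth_mktuple.
Qed.

Lemma insert_binary1 N V W (x : N.-tuple V) (f : cochain 2 V W) w X :
  insert x f 1 w X
  = lext (fun v => lsubst (fun=> lvar N 0) (f [tuple nth 0 x 0; v])) X.
Proof.
rewrite /insert; congr lext; apply/funext => v; rewrite lsubst_var1 /=.
congr (lsubst _ (f _)); apply: eq_from_tnth => -[[|[|//]] k2].
  by rewrite tnth_mktuple.
by rewrite tnth_mktuple.
Qed.

Lemma consecutive_binary N V W (x : N.-tuple V) (f : cochain 2 V W) i :
  consecutive x f i
  = lsubst (fun=> lvar N i) (f [tuple nth 0 x i; nth 0 x i.+1]).
Proof.
rewrite /consecutive lsubst_var1 addn0.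
congr (lsubst _ (f _)); apply: eq_from_tnth => -[[|[|//]] k2].
  by rewrite tnth_mktuple /= addn0.
by rewrite tnth_mktuple /= addn1.
Qed.

Lemma binary_klinearl V W (f : cochain 2 V W) y : multilinear f ->
  klinear (fun v => f [tuple v; y]).
Proof.
move=> linf c v w; pose t := [tuple 0; y].
have E u : [tuple u; y] = tupdate t 0 u.
  by apply: eq_from_tnth => -[[|[|//]] k2]; rewrite tnth_mktuple.
rewrite !E; exact: linf.
Qed.

Lemma binary_klinearr V W (f : cochain 2 V W) x : multilinear f ->
  klinear (fun v => f [tuple x; v]).
Proof.
move=> linf c v w; pose t := [tuple x; 0].
have E u : [tuple x; u] = tupdate t 1 u.
  by apply: eq_from_tnth => -[[|[|//]] k2]; rewrite tnth_mktuple.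
rewrite !E; exact: linf.
Qed.

(** For a unary [g] the sign of slot [i] has the even exponent [i * 2], so both insertions enter
    with a plus. *)
Lemma gcirc_const_r V (f : cochain 2 V V) (g : cochain 1 V V) (phi : V -> V) x :
  multilinear f ->
  (forall y, g y = lpol_const (phi (tnth y 0))) ->
  gcirc 2 f g x = f [tuple phi (tnth x 0); tnth x 1]
                 + f [tuple tnth x 0; phi (tnth x 1)].
Proof.
move=> linf gE; rewrite /gcirc big_ord_recl big_ord1 /= insert_binary0 insert_binary1.
rewrite !(consecutive_const _ _ gE) expr0 scale1r mul1n sqrrN expr1n scale1r.
rewrite big_nat1 !lext_const.
- by rewrite !lreduce_lambda0 !(tnth_nth 0).
- exact/lsubst_klinear/binary_klinearr.
- exact/lsubst_klinear/binary_klinearl.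
Qed.

Lemma gcirc_const_l V (f : cochain 1 V V) (g : cochain 2 V V) (phi : V -> V) x :
  linear phi ->
  (forall y, f y = lpol_const (phi (tnth y 0))) ->
  gcirc 2 f g x = lmap phi (g x).
Proof.
move=> linphi fE; rewrite /gcirc big_ord1 /= (insert_const _ _ _ fE) expr0 scale1r.
rewrite /lreduce -(lmap_lsubst _ _ linphi) -/(lreduce _) consecutive_binary lreduce_lambda0.
congr (lmap _ (g _)).
by apply: eq_from_tnth => -[[|[|//]] k2]; rewrite !(tnth_nth 0).
Qed.

End Slots.

(** * The Gerstenhaber bracket [π, R]_G and its components *)

Section OperatorComplex.
Context {K : fieldType} (T : conf_algebra K) (U : conf_bimodule T) (H : cocycle2 U).
Context (R : {linear U -> T}).
Local Notation TU := (T * U)%type.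

(** [inT] and [inU] are convertible with the anonymous inclusions inside [semidirect], [extend] and
    [restrict]; having names, they can be handled by rewriting. *)
Definition inT (t : T) : TU := (t, 0).
Definition inU (u : U) : TU := (0, u).

Lemma inT_linear : linear inT.
Proof. by move=> c v w; congr pair; rewrite /= scaler0 addr0. Qed.

Lemma inU_linear : linear inU.
Proof. by move=> c v w; congr pair; rewrite /= scaler0 addr0. Qed.

Lemma fst_linear : linear (@fst T U). Proof. by []. Qed.
Lemma snd_linear : linear (@snd T U). Proof. by []. Qed.
Lemma R_linear : linear R. Proof. exact: linearP. Qed.

Lemma lmap_fst_inT n (X : lpol n T) : lmap fst (lmap inT X) = X.
Proof. by rewrite lmap_comp ?lmap_id //; exact: inT_linear. Qed.

Lemma lmap_fst_inU n (X : lpol n U) : lmap fst (lmap inU X) = 0.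
Proof. by rewrite lmap_comp ?lmap_zero //; exact: inU_linear. Qed.

Lemma lmap_snd_inT n (X : lpol n T) : lmap snd (lmap inT X) = 0.
Proof. by rewrite lmap_comp ?lmap_zero //; exact: inT_linear. Qed.

Lemma lmap_snd_inU n (X : lpol n U) : lmap snd (lmap inU X) = X.
Proof. by rewrite lmap_comp ?lmap_id //; exact: inU_linear. Qed.

Lemma extend_cochain1 y :
  extend (cochain1 R) y = lpol_const (inT (R (tnth y 0).2)).
Proof. by rewrite /extend /cochain1 tnth_mktuple (lmap_const _ inT_linear). Qed.

Lemma semidirectE p u q v : semidirect [tuple ((p, u) : TU); (q, v)]
  = lmap inT (cmul p q) + lmap inU (lmul p v + rmul u q).
Proof. by []. Qed.

Definition bracket_pi_R : cochain 2 TU TU :=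
  gbracket (@semidirect K T U) (extend (cochain1 R)).

Lemma inT_R_linear : linear (fun z : TU => inT (R z.2)).
Proof. by move=> c x y; rewrite /= linearP inT_linear. Qed.

(** [π, R]_G measures how far [R], extended by zero to [T * U], is from being a derivation of π. *)
Lemma bracket_pi_R_pair (x y : TU) : bracket_pi_R [tuple x; y]
  = semidirect [tuple inT (R x.2); y] + semidirect [tuple x; inT (R y.2)]
    - lmap (fun z : TU => inT (R z.2)) (semidirect [tuple x; y]).
Proof.
have eR := gcirc_const_r (phi := fun z : TU => inT (R z.2)) [tuple x; y]
  (@semidirect_multilinear _ _ _) extend_cochain1.
have eL := gcirc_const_l (phi := fun z : TU => inT (R z.2)) (@semidirect K T U)
  [tuple x; y] inT_R_linear extend_cochain1.
(* The exponent 6 is [3 * 2], the Gerstenhaber sign for arities 2 and 1. *)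
refine (etrans (congr2 (fun a b : lpol 1 TU => a - (-1) ^+ 6 *: b) eR eL) _).
by rewrite -signr_odd scale1r.
Qed.

(** These three maps are the induced product and the two induced actions in the case [H = 0]. *)
Definition untwisted_mul (u v : U) : lpol 1 U := rmul u (R v) + lmul (R u) v.
Definition untwisted_lact (u : U) (p : T) : lpol 1 T := cmul (R u) p - lmap R (rmul u p).
Definition untwisted_ract (p : T) (u : U) : lpol 1 T := cmul p (R u) - lmap R (lmul p u).

Lemma zero_products : [/\ forall p : T, cmul p 0 = 0, forall p : T, cmul 0 p = 0,
  forall p : T, @lmul _ _ U p 0 = 0 & forall u, @lmul _ _ U 0 u = 0] /\
  (forall u, @rmul _ _ U u 0 = 0) /\ (forall p, @rmul _ _ U 0 p = 0).
Proof.
have [ml mr _ _] := cmul_sesquilinear T.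
have [ll lr _ _] := @lmul_sesquilinear _ _ U.
have [rl rr _ _] := @rmul_sesquilinear _ _ U.
split; split=> p.
- exact: (klinear0 (phi := cmul p)).
- exact: (klinear0 (phi := (@cmul K T)^~ p)).
- exact: (klinear0 (phi := @lmul _ _ U p)).
- exact: (klinear0 (phi := (@lmul _ _ U)^~ p)).
- exact: (klinear0 (phi := @rmul _ _ U p)).
- exact: (klinear0 (phi := (@rmul _ _ U)^~ p)).
Qed.

Lemma R_snd_linear : linear (fun z : TU => R z.2).
Proof. by move=> c x y; rewrite /= linearP. Qed.

(** The summand in which [R] is applied after π has values in [T], so [snd] removes it; the two
    derivation-like summands give the product. *)
Lemma snd_bracket_pi_R (u v : U) :
  lmap snd (bracket_pi_R [tuple inU u; inU v]) = untwisted_mul u v.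
Proof.
have [[c0 c0' l0 l0'] [r0 r0']] := zero_products.
rewrite bracket_pi_R_pair !semidirectE /= !(lmapD snd_linear) (lmapN snd_linear).
rewrite !lmap_snd_inU !lmap_snd_inT !add0r (lmap_comp _ inT_R_linear snd_linear).
by rewrite lmap_zero subr0 r0' l0' addr0 add0r addrC.
Qed.

Lemma lmap_R_snd n (X : lpol n T) (Y : lpol n U) :
  lmap fst (lmap (fun z : TU => inT (R z.2)) (lmap inT X + lmap inU Y)) = lmap R Y.
Proof.
rewrite (lmap_comp _ inT_R_linear fst_linear) (lmapD R_snd_linear).
rewrite (lmap_comp _ inT_linear R_snd_linear) (lmap_comp _ inU_linear R_snd_linear).
by rewrite /= linear0 lmap_zero add0r.
Qed.

(** The extended [R] vanishes on [T], so one derivation-like summand drops out. The other gives the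
    product in [T], and [R] after π gives the correction term. *)
Lemma fst_bracket_pi_Rl (p : T) (u : U) :
  lmap fst (bracket_pi_R [tuple inT p; inU u]) = untwisted_ract p u.
Proof.
have [[c0 c0' l0 l0'] [r0 r0']] := zero_products.
rewrite bracket_pi_R_pair !semidirectE (lmapD fst_linear) (lmapN fst_linear) lmap_R_snd.
rewrite /= !(lmapD fst_linear) !lmap_fst_inU !lmap_fst_inT !addr0.
by rewrite linear0 c0' add0r r0 addr0.
Qed.

Lemma fst_bracket_pi_Rr (u : U) (p : T) :
  lmap fst (bracket_pi_R [tuple inU u; inT p]) = untwisted_lact u p.
Proof.
have [[c0 c0' l0 l0'] [r0 r0']] := zero_products.
rewrite bracket_pi_R_pair !semidirectE (lmapD fst_linear) (lmapN fst_linear) lmap_R_snd.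
rewrite /= !(lmapD fst_linear) !lmap_fst_inU !lmap_fst_inT !addr0.
by rewrite linear0 c0 addr0 l0 add0r.
Qed.

Lemma bracket_pi_R_multilinear : multilinear bracket_pi_R.
Proof.
apply: (@gbracket_multilinear K 2 1); first exact: semidirect_multilinear.
exact/extend_multilinear/cochain1_multilinear.
Qed.

(** The action is a component of [π, R]_G and inherits linearity from its multilinearity. *)
Lemma untwisted_lact_klinearl p : klinear (fun u => untwisted_lact u p).
Proof.
move=> c v w; rewrite -!fst_bracket_pi_Rr inU_linear -lmap_lpol_linear //; congr lmap.
by rewrite (binary_klinearl _ bracket_pi_R_multilinear).
Qed.

Lemma untwisted_ract_klinearr p : klinear (untwisted_ract p).
Proof.
move=> c v w; rewrite -!fst_bracket_pi_Rl inU_linear -lmap_lpol_linear //; congr lmap.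
by rewrite (binary_klinearr _ bracket_pi_R_multilinear).
Qed.

(** * Comparison of d_R and δ_Hoch term by term *)

Section Terms.
Context (m : nat) (g : cochain m U T) (x : m.+1.-tuple U).
Context (ling : multilinear g).
Local Notation y k := (nth 0 x k).
Local Notation N := m.+1.
Local Notation psum := (\sum_(k < m) lvar N k : lring K N).
Local Notation cc k := (lpol_const (nth 0 x k) : lpol N U).
(** This is the tuple at which [restrict] evaluates its argument when applied to [x]. *)
Let x' : m.+1.-tuple TU := [tuple inU (tnth x k) | k < m.+1].

Lemma nth_inU k : nth 0 x' k = inU (nth 0 x k).
Proof.
case: (ltnP k m.+1) => km; last by rewrite !nth_default ?size_tuple.
by rewrite -[k]/(val (Ordinal km)) -!tnth_nth tnth_mktuple.
Qed.

Lemma consecutive_extend i :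
  consecutive x' (extend g) i = lmap inT (consecutive x g i).
Proof.
rewrite /consecutive /extend (lmap_lsubst _ _ inT_linear).
congr (lsubst _ (lmap _ (g _))); apply: eq_mktuple => k.
by rewrite tnth_mktuple nth_inU.
Qed.

(** The value of [g] lies in [T] and sits in slot 1 after an argument from [U]; this configuration
    selects the left action from [π, R]_G. *)
Lemma left_term :
  lmap fst (lreduce (insert x' bracket_pi_R 1 m (consecutive x' (extend g) 1)))
  = lreduce (lprod untwisted_lact (lvar N 0) (cc 0) (consecutive x g 1)).
Proof.
have linD := binary_klinearr (nth 0 x' 0) bracket_pi_R_multilinear.
have linF := lsubst_klinear (fun=> lvar m.+1 0) linD.
rewrite [LHS]lmap_lsubst //; congr lsubst.
rewrite insert_binary1 consecutive_extend (lext_lmap _ inT_linear linF).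
have linG := klinear_comp inT_linear linF.
rewrite (lmap_lext _ fst_linear linG).
rewrite lprod_constl; last exact: untwisted_lact_klinearl.
congr lext; apply/funext => t.
by rewrite lmap_lsubst // nth_inU fst_bracket_pi_Rr.
Qed.

Lemma right_term :
  lmap fst (lreduce (insert x' bracket_pi_R 0 m (consecutive x' (extend g) 0)))
  = lreduce (lprod untwisted_ract psum (consecutive x g 0) (cc m)).
Proof.
have linD := binary_klinearl (nth 0 x' m) bracket_pi_R_multilinear.
have linF := lsubst_klinear (fun=> \sum_(0 <= l < m) lvar m.+1 l) linD.
rewrite [LHS]lmap_lsubst //; congr lsubst.
rewrite insert_binary0 consecutive_extend (lext_lmap _ inT_linear linF).
have linG := klinear_comp inT_linear linF.
rewrite (lmap_lext _ fst_linear linG).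
rewrite lprod_constr; last exact: untwisted_ract_klinearr.
congr lext; apply/funext => t.
by rewrite lmap_lsubst // nth_inU fst_bracket_pi_Rl big_mkord.
Qed.

Lemma middle_term (i : 'I_m) :
  lmap fst (lreduce (insert x' (extend g) i 2 (consecutive x' bracket_pi_R i)))
  = lreduce (insert x g i 2 (lsubst (fun=> lvar m.+1 i)
      (untwisted_mul (nth 0 x i) (nth 0 x i.+1)))).
Proof.
have linF := splice_klinear (fun k : 'I_m.-1 =>
  splice i 2 (\sum_(i <= l < i + 2) lvar m.+1 l) (lvar m.+1) k) 2 (nth 0 x) ling (ltn_ord i).
(* [extend g] sees only the [U]-components of its arguments, so the inserted value may first be
   projected by [snd], which leaves the product on [U]. *)
have -> : insert x' (extend g) i 2 (consecutive x' bracket_pi_R i)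
    = lmap inT (insert x g i 2 (lmap snd (consecutive x' bracket_pi_R i))).
  rewrite [in RHS]/insert (lext_lmap _ snd_linear linF).
  have linG := klinear_comp snd_linear linF.
  rewrite (lmap_lext _ inT_linear linG).
  congr lext; apply/funext => v; rewrite (lmap_lsubst _ _ inT_linear).
  congr (lsubst _ (lmap _ (g _))); apply: eq_mktuple => k.
  rewrite tnth_mktuple /splice !nth_inU.
  by case: ifP => // _; case: ifP.
rewrite [LHS]lmap_lsubst // lmap_fst_inT consecutive_binary lmap_lsubst //.
by rewrite !nth_inU snd_bracket_pi_R.
Qed.

Definition untwisted_left :=
  lreduce (lprod untwisted_lact (lvar N 0) (cc 0) (consecutive x g 1)).
Definition untwisted_right :=
  lreduce (lprod untwisted_ract psum (consecutive x g 0) (cc m)).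
Definition untwisted_middle (i : 'I_m) := lreduce (insert x g i 2
  (lsubst (fun=> lvar N i) (untwisted_mul (y i) (y i.+1)))).

Definition twist_left := lreduce (lmap R (lprod (cocycle_fun H) (lvar N 0)
  (lpol_const (R (y 0))) (consecutive x g 1))).
Definition twist_right := lreduce (lmap R (lprod (cocycle_fun H) psum
  (consecutive x g 0) (lpol_const (R (y m))))).
Definition twist_middle (i : 'I_m) := lreduce (insert x g i 2
  (lprod (cocycle_fun H) (lvar N i) (lpol_const (R (y i))) (lpol_const (R (y i.+1))))).

(** Slot 0 of [π, R]_G has sign 1 and slot 1 has sign (-1)^(m+1). Together with the leading -1 and
    the Gerstenhaber sign this leaves the Hochschild signs up to the common factor (-1)^m. *)
Lemma bracket2E : bracket2 (cochain1 R) g x = (-1) ^+ m *: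
  (untwisted_left + \sum_(i < m) (-1) ^+ i.+1 *: untwisted_middle i
    + (-1) ^+ m.+1 *: untwisted_right).
Proof.
(* The factor [(-1) ^+ 1] comes from [R] having arity 1, and [3 * m.+1] from the outer bracket of a
   2-cochain with an m-cochain. *)
rewrite -[LHS]/((-1) ^+ 1 *: lmap fst (gcirc N bracket_pi_R (extend g) x'
  - (-1) ^+ (3 * m.+1) *: gcirc N (extend g) bracket_pi_R x')).
rewrite (lmapD fst_linear) (lmapN fst_linear) (lmapZ _ _ fst_linear).
rewrite /gcirc !(lmap_sum _ fst_linear) big_ord_recl big_ord1 /=.
rewrite !(lmapZ _ _ fst_linear).
rewrite left_term right_term.
under eq_bigr => i _ do rewrite (lmapZ _ _ fst_linear) middle_term.
rewrite -/untwisted_left -/untwisted_right.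
have sign3 k : (-1) ^+ (k * 3) = (-1) ^+ k :> K by rewrite -signr_odd oddM andbT signr_odd.
pose S := \sum_(i < m) (-1) ^+ i *: untwisted_middle i.
have -> : \sum_(i < m) (-1) ^+ i.+1 *: untwisted_middle i = - S.
  by rewrite -sumrN; apply: eq_bigr => i _; rewrite exprS mulN1r scaleNr.
under eq_bigr => i _ do rewrite sign3 -/(untwisted_middle i).
rewrite -/S (mulnC 3) sign3 mul0n expr0 scale1r mul1n expr1 exprS mulN1r !scaleNr scale1r.
rewrite !scalerDr !scalerN !scalerA -expr2 sqrr_sign scale1r !opprD !opprK.
by rewrite -addrA addrC.
Qed.

Let cochain1E z : cochain1 R z = lpol_const (R (tnth z 0)).
Proof. by []. Qed.

(** [R] has a single slot, so the sum in [plug] has one term, and inserting into [R] is applying [R]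
    coefficientwise to the value of [H]. *)
Lemma plug_left : plug H N (cochain1 R) (cochain1 R) g x = twist_left.
Proof.
rewrite /plug big_ord1 expr0 scale1r.
rewrite (insert_const x _ _ cochain1E); congr (lreduce (lmap _ _)).
by rewrite (consecutive_const x _ cochain1E) big_nat1.
Qed.

Lemma plug_right : plug H N (cochain1 R) g (cochain1 R) x = twist_right.
Proof.
rewrite /plug big_ord1 expr0 scale1r.
rewrite (insert_const x _ _ cochain1E); congr (lreduce (lmap _ _)).
by rewrite (consecutive_const x _ cochain1E) big_mkord.
Qed.

Lemma plug_middle : plug H N g (cochain1 R) (cochain1 R) x
  = \sum_(i < m) (-1) ^+ i *: twist_middle i.
Proof.
apply: eq_bigr => i _; rewrite muln1; congr (_ *: lreduce (insert _ _ _ _ _)).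
by rewrite !(consecutive_const x _ cochain1E) addn1 big_nat1.
Qed.

Context (two_neq0 : 2%:R != 0 :> K).

Lemma bracket3E : - (2%:R^-1 *: bracket3 H (cochain1 R) (cochain1 R) g x)
  = (-1) ^+ m *: (- twist_left + \sum_(i < m) (-1) ^+ i.+1 *: twist_middle i
      - (-1) ^+ m.+1 *: twist_right).
Proof.
(* The definition is spelled out at a = b = 1, c = m. The signs within each pair agree: 1 and
   -(-1)^1, then -(-1)^m and (-1)^(1+m), then -(-1)^(1+2m) and (-1)^(2m). *)
rewrite -[bracket3 _ _ _ _ _]/((-1) ^+ (1 * 1 * m) *:
  (plug H N (cochain1 R) (cochain1 R) g x
   - (-1) ^+ (1 * m) *: plug H N (cochain1 R) g (cochain1 R) x
   - (-1) ^+ (1 * 1) *: plug H N (cochain1 R) (cochain1 R) g x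
   + (-1) ^+ (1 * (1 + m)) *: plug H N (cochain1 R) g (cochain1 R) x
   - (-1) ^+ (1 * 1 + 1 * m + m * 1) *: plug H N g (cochain1 R) (cochain1 R) x
   + (-1) ^+ (m * (1 + 1)) *: plug H N g (cochain1 R) (cochain1 R) x)).
rewrite plug_left plug_right plug_middle.
pose S := \sum_(i < m) (-1) ^+ i *: twist_middle i.
have -> : \sum_(i < m) (-1) ^+ i.+1 *: twist_middle i = - S.
  by rewrite -sumrN; apply: eq_bigr => i _; rewrite exprS mulN1r scaleNr.
rewrite -/S !mulnDr !muln1 !mul1n !exprD !expr1.
set e := (-1) ^+ m; have ee : e * e = 1 :> K by rewrite -expr2 sqrr_sign.
rewrite !mulN1r mulNr ee !scaleNr !scale1r !opprK.
have -> : twist_left - e *: twist_right + twist_left - e *: twist_right + S + S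
    = 2%:R *: (twist_left - e *: twist_right + S).
  by rewrite scaler_nat mulr2n addrACA !addrA.
rewrite scalerA scalerA [_ * 2%:R]mulrC mulVKf // -scalerN; congr (_ *: _).
by rewrite !opprD opprK addrAC.
Qed.

Let linHl p : klinear ((cocycle_fun H)^~ p).
Proof. by have [linH _ _ _] := cocycle_sesquilinear H; move=> c v w; apply: linH. Qed.
Let linHr p : klinear (cocycle_fun H p).
Proof. by have [_ linH _ _] := cocycle_sesquilinear H; move=> c v w; apply: linH. Qed.

(** The shape [c *: _ + _] with [c = -1] is the one that [klinear_comb], [lsubst_linear] and
    [lext_phi_linear] accept. *)
Lemma induced_lactE u p :
  induced_lact H R u p = (-1) *: lmap R (cocycle_fun H (R u) p) + untwisted_lact u p.
Proof.
by rewrite /induced_lact (lmapD R_linear) scaleN1r opprD addrA addrC.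
Qed.

Lemma induced_ractE p u :
  induced_ract H R p u = (-1) *: lmap R (cocycle_fun H p (R u)) + untwisted_ract p u.
Proof.
by rewrite /induced_ract (lmapD R_linear) scaleN1r opprD addrA addrC.
Qed.

Lemma left_split : lreduce (lprod (induced_lact H R) (lvar N 0) (cc 0) (consecutive x g 1))
  = untwisted_left - twist_left.
Proof.
have linR := R_linear.
have linl p : klinear (fun u => lmap R (cocycle_fun H (R u) p)).
  by move=> c v w; rewrite linR linHl lmap_lpol_linear.
have linr : klinear (fun p => lsubst (fun=> lvar N 0) (cocycle_fun H (R (y 0)) p)).
  exact: lsubst_klinear.
rewrite /untwisted_left /twist_left -lreduceB; congr lreduce.
rewrite !lprod_constl //; first last.
- move=> p c v w; rewrite !induced_lactE.
  exact: (klinear_comb (-1) (linl p) (untwisted_lact_klinearl p)).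
- exact: untwisted_lact_klinearl.
rewrite (lmap_lext _ linR linr) addrC -scaleN1r; apply: lext_phi_linear => p.
by rewrite induced_lactE lsubst_linear (lmap_lsubst _ _ linR).
Qed.

Lemma right_split : lreduce (lprod (induced_ract H R) psum (consecutive x g 0) (cc m))
  = untwisted_right - twist_right.
Proof.
have linR := R_linear.
have linr p : klinear (fun u => lmap R (cocycle_fun H p (R u))).
  by move=> c v w; rewrite linR linHr lmap_lpol_linear.
have linl : klinear (fun p => lsubst (fun=> psum) (cocycle_fun H p (R (y m)))).
  by apply: lsubst_klinear; exact: linHl.
rewrite /untwisted_right /twist_right -lreduceB; congr lreduce.
rewrite !lprod_constr //; first last.
- move=> p c v w; rewrite !induced_ractE.
  exact: (klinear_comb (-1) (linr p) (untwisted_ract_klinearr p)).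
- exact: untwisted_ract_klinearr.
rewrite (lmap_lext _ linR linl) addrC -scaleN1r; apply: lext_phi_linear => p.
by rewrite induced_ractE lsubst_linear (lmap_lsubst _ _ linR).
Qed.

Lemma middle_split (i : 'I_m) :
  lreduce (insert x g i 2 (lprod (induced_mul H R) (lvar N i) (cc i) (cc i.+1)))
  = untwisted_middle i + twist_middle i.
Proof.
have [ll lr _ _] := @lmul_sesquilinear _ _ U.
have [rl rr _ _] := @rmul_sesquilinear _ _ U.
rewrite /untwisted_middle /twist_middle -lreduceD; congr lreduce.
rewrite !lprod_const //; first last.
- move=> u c v w; rewrite /= /induced_mul linearP rr lr linHr.
  by rewrite !scalerDr [X in X + _ = _]addrACA [LHS]addrACA.
- move=> u c v w; rewrite /= /induced_mul rl linearP ll linHl.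
  by rewrite !scalerDr [X in X + _ = _]addrACA [LHS]addrACA.
set M := untwisted_mul _ _; set C := cocycle_fun H _ _.
(* The coefficient 1 brings the sum into the form in which [lsubst_linear] and [insert_linearr]
   rewrite. *)
have -> : induced_mul H R (y i) (y i.+1) = 1 *: M + C by rewrite scale1r.
by rewrite lsubst_linear insert_linearr // scale1r.
Qed.

(** The expansions of the two brackets share the factor (-1)^m, and what remains are the untwisted
    and twisted halves of the three kinds of Hochschild terms. *)
Lemma d_RB_d_Hoch : d_RB H R g x = (-1) ^+ m *:
  d_Hoch (induced_mul H R) (induced_lact H R) (induced_ract H R) g x.
Proof.
rewrite -[LHS]/(bracket2 (cochain1 R) g x
  - 2%:R^-1 *: bracket3 H (cochain1 R) (cochain1 R) g x).
rewrite bracket2E bracket3E -scalerDr; congr (_ *: _).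
rewrite /d_Hoch 2!lreduceD lreduceZ left_split right_split.
rewrite (big_morph _ (@lreduceD _ _ _) (@lreduce0 _ _ _)).
under [in RHS]eq_bigr => i _ do rewrite lreduceZ middle_split scalerDr.
rewrite big_split /= [in RHS]scalerBr [untwisted_left - _ + _]addrACA [RHS]addrACA.
by rewrite -!addrA.
Qed.

End Terms.
End OperatorComplex.

(** * Cohomology under rescaling of the differential *)

Section Complexes.
Context {K : fieldType}.

(** Predicates with the same members are equal by extensionality, and the closure proofs by proof
    irrelevance. The two quotients then become the same type, and the identity is the
    isomorphism. *)
Lemma quotient_congr (X : lmodType K) (Z Z' : subspace X) (B B' : {pred X})
    (hB : submod_closed [pred z : carrier Z | val z \in B])
    (hB' : submod_closed [pred z : carrier Z' | val z \in B']) :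
  Z =i Z' -> B =i B' ->
  exists phi : {linear quotient (Subspace hB) -> quotient (Subspace hB')}, bijective phi.
Proof.
case: Z Z' hB hB' => [Z hZ] [Z' hZ'] hB hB' ZZ' BB'.
have eZ : Z = Z' by apply/funext.
have eB : B = B' by apply/funext.
subst Z' B'; have eh := Prop_irrelevance hZ hZ'; subst hZ'.
have eh := Prop_irrelevance hB hB'; subst hB'.
by exists idfun; exists idfun.
Qed.

Lemma cohomology_scaled_differential (X : nat -> lmodType K) (C : forall m, subspace (X m))
    (d d' : forall m, {linear X m -> X m.+1}) (e : nat -> K) :
  (forall m, e m != 0) ->
  (forall m g, g \in subspace_pred (C m) -> d m g = e m *: d' m g) ->
  forall m, exists phi : {linear cohomology C d m -> cohomology C d' m}, bijective phi.
Proof.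
move=> e0 dd' m; apply: quotient_congr => [g|].
  rewrite !inE; case: (boolP (g \in _)) => //= Cg.
  by rewrite dd' // scaler_eq0 (negPf (e0 m)).
(* In degree 0 both coboundary predicates are [pred1 0]. In degree [m.+1] a preimage under one
   differential becomes a preimage under the other after scaling by [e m] or its inverse. *)
case: m => [|m] g //=; rewrite !inE; apply: asbool_equiv_eq; split=> -[h Ch ->].
  by exists (e m *: h); rewrite ?rpredZ // dd' // linearZ.
exists ((e m)^-1 *: h); rewrite ?rpredZ // dd' ?rpredZ // linearZ scalerA.
by rewrite mulfV // scale1r.
Qed.

End Complexes.

(** A [realType] is a model of the real numbers, so [F[i]] is the field of complex numbers. *)
Theorem theorem3p5 (F : realType) (T : conf_algebra F[i])
    (U : conf_bimodule T) (H : cocycle2 U) (R : twisted_RB H) (m : nat) :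
  exists phi : {linear RB_cohomology R m -> Hoch_cohomology R m}, bijective phi.
Proof.
pose d k : {linear cochain k U T -> cochain k.+1 U T} := d_RB H R (m := k).
pose d' k : {linear cochain k U T -> cochain k.+1 U T} := @d_Hoch_induced _ _ _ H R k.
have e0 k : (-1) ^+ k != 0 :> F[i] by rewrite signr_eq0.
apply: (cohomology_scaled_differential (C := fun k => Defs.Hom k U T) (d := d) (d' := d') e0)
  => k g.
rewrite inE => /asboolP[ling _ _]; apply/funext => x.
apply: d_RB_d_Hoch => //.
(* Characteristic zero makes 2 invertible, as the factor 1/2 in [d_RB] requires. *)
by rewrite Num.Theory.pnatr_eq0.
Qed.
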